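(* Fix an equation $(f,q,w)$ as in the context with $\prod_{i=0}^{N-1}(1/f_i)>0$. Let $\gamma\in(-\pi,0)\cup(0,\pi)$ and $K=(k_{ij})\in SL(2,\mathbb R)$ with $k_{11}-f_0k_{12}\neq0$. For $M\in\{K,-K\}$ with entries $m_{ij}$, write $\lambda_j(M)$, $\lambda_j(-M)$, $\lambda_j(e^{i\gamma}M)$ for the eigenvalues with boundary conditions $[M|-I]$, $[-M|-I]$, $[e^{i\gamma}M|-I]$, and $\lambda_j(\mathbf S_K)$ for those with $\mathbf S_K=\begin{pmatrix}1&0&0&0\\0&0&-k_{22}&k_{12}\end{pmatrix}$. Put $m_j=\min\{\lambda_j(M),\lambda_j(-M)\}$ and $M_j=\max\{\lambda_j(M),\lambda_j(-M)\}$. Say that property $P(M)$ holds if for every $0\le j\le N-1$: $\lambda_j(M)<\lambda_j(e^{i\gamma}M)<\lambda_j(-M)$ when $j$ is even, and $\lambda_j(-M)<\lambda_j(e^{i\gamma}M)<\lambda_j(M)$ when $j$ is odd. Then for each $M\in\{K,-K\}$: (i) if $m_{11}-f_0m_{12}>0$ and $m_{12}>0$: $P(M)$ holds, $\lambda_j(\mathbf S_K)\le m_j$ for $0\le j\le N-1$, and $M_j\le\lambda_{j+1}(\mathbf S_K)$ for $0\le j\le N-2$; (ii) if $m_{11}-f_0m_{12}>0$ and $m_{12}<0$: $P(M)$ holds, $M_j\le\lambda_j(\mathbf S_K)\le m_{j+1}$ for $0\le j\le N-2$, and $M_{N-1}\le\lambda_{N-1}(\mathbf S_K)$; (iii) if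 $m_{11}>0$ and $m_{12}=0$: $P(M)$ holds and $M_j\le\lambda_j(\mathbf S_K)\le m_{j+1}$ for $0\le j\le N-2$.
   Context: Let $N\ge2$ be an integer. An equation is given by real sequences $f=\{f_n\}_{n=0}^N$, $q=\{q_n\}_{n=1}^N$, $w=\{w_n\}_{n=1}^N$ with $f_n\neq0$, $w_n>0$; it is $-\nabla(f_n\Delta y_n)+q_ny_n=\lambda w_ny_n$, $1\le n\le N$, for $y=\{y_n\}_{n=0}^{N+1}$, $\Delta y_n=y_{n+1}-y_n$, $\nabla y_n=y_n-y_{n-1}$. A boundary condition $[A\,|\,B]$ (equivalently the $2\times4$ coefficient matrix $(A,B)$ of rank 2) is $A(y_0,f_0\Delta y_0)^T+B(y_N,f_N\Delta y_N)^T=0$; matrices differing by left multiplication by an invertible $2\times2$ complex matrix give the same condition (so $\mathbf S_{-K}=\mathbf S_K$). $SL(2,\mathbb R)$: real $2\times2$ matrices of determinant 1; $I$ the identity. Eigenvalues ($\lambda$ with a nontrivial solution) of these self-adjoint problems are real; multiplicity = dimension of the solution space (equal to the multiplicity as a zero of the characteristic polynomial); counted with multiplicity they are ordered $\lambda_0\le\lambda_1\le\cdots$. *)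

(* Defs.v *)
From mathcomp Require Import all_boot all_algebra.
From mathcomp Require Export complex.
From mathcomp Require Export reals trigo boolp.
Import GRing.Theory Num.Theory.
Unset Printing Implicit Defensive.
Local Open Scope ring_scope.
Local Open Scope complex_scope.

Section SturmLiouville.
Variable R : realType.
Local Notation C := R[i].

(* Data: N, f = (f_0..f_N), q = (q_1..q_N), w = (w_1..w_N) (as nat -> R; other
   indices are irrelevant).  A boundary condition [A | B] is a pair of 2x2
   complex matrices. *)

(* For y = (y_0, ..., y_{N+1}) given as Y : nat -> C, the residual of
   constraint number c (c : 'I_(N+2)):
   - c = n-1 for 1 <= n <= N : the equation
        -(f_n Δy_n - f_{n-1} Δy_{n-1}) + q_n y_n - λ w_n y_n ;
   - c = N, N+1 : rows 1, 2 of  A (y_0, f_0Δy_0)^T + B (y_N, f_NΔy_N)^T. *)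
Definition sl_residual (N : nat) (f q w : nat -> R) (A B : 'M[C]_2) (lam : C)
    (c : 'I_N.+2) (Y : nat -> C) : C :=
  let D k := Y k.+1 - Y k in
  let F k := (f k)%:C * D k in
  if (c < N)%N then
    let n := c.+1 in
    - (F n - F n.-1) + (q n)%:C * Y n - lam * (w n)%:C * Y n
  else
    let i : 'I_2 := if (c == N :> nat) then 0 else 1 in
    A i 0 * Y 0%N + A i 1 * F 0%N + B i 0 * Y N + B i 1 * F N.

Definition sl_solution N f q w A B lam (y : 'rV[C]_N.+2) : Prop :=
  forall c, sl_residual N f q w A B lam c (fun k => y 0 (inord k)) = 0.

(* The matrix of the (linear) constraints: y is a solution iff y *m sl_matrix = 0
   (column c of the matrix is the linear form sl_residual _ c). *)
Definition sl_matrix N f q w A B lam : 'M[C]_N.+2 :=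
  \matrix_(k, c) sl_residual N f q w A B lam c (fun i => ((i == k :> nat)%:R : C)).

(* Multiplicity of lam = dimension of the solution space = dim of the row
   kernel of sl_matrix (0 iff lam is not an eigenvalue). *)
Definition sl_mult N f q w A B (lam : C) : nat :=
  \rank (kermx (sl_matrix N f q w A B lam)).

(* s is the nondecreasing list of the eigenvalues counted with multiplicity:
   every complex lam has multiplicity equal to its number of occurrences in s
   (in particular all eigenvalues are real). *)
Definition sl_eigen_list N f q w A B (s : seq R) : Prop :=
  sorted <=%R s /\
  forall z : C, sl_mult N f q w A B z = count (fun x : R => x%:C == z) s.

Definition sl_spectrum N f q w A B : seq R :=
  match pselect (exists s, sl_eigen_list N f q w A B s) with
  | left H => proj1_sig (cid H)
  | right _ => [::]
  end.

Definition sl_eig N f q w A B (j : nat) : R := nth 0 (sl_spectrum N f q w A B) j.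

Definition real_bc (M : 'M[R]_2) : 'M[C]_2 * 'M[C]_2 :=
  (map_mx (real_complex R) M, -1).

Definition phase_bc (gamma : R) (M : 'M[R]_2) : 'M[C]_2 * 'M[C]_2 :=
  ((cos gamma +i* sin gamma) *: map_mx (real_complex R) M, -1).

Definition SK_bc (K : 'M[R]_2) : 'M[C]_2 * 'M[C]_2 :=
  (\matrix_(i < 2, j < 2) (if (i == 0) && (j == 0) then 1 else 0),
   \matrix_(i < 2, j < 2)
     (if i == 0 then 0 else if j == 0 then - (K 1 1)%:C else (K 0 1)%:C)).

Definition eig_bc N f q w (bc : 'M[C]_2 * 'M[C]_2) (j : nat) : R :=
  sl_eig N f q w bc.1 bc.2 j.

End SturmLiouville.

Arguments eig_bc {R} N f q w bc j.
Arguments real_bc {R} M.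
Arguments phase_bc {R} gamma M.
Arguments SK_bc {R} K.

(* Main.v *)
Require Import Defs.
From mathcomp Require Import all_boot all_order all_algebra.
From mathcomp Require Import complex reals trigo.
From mathcomp Require Import ring lra zify.
From mathcomp Require Import polyrcf.
Import Order.TTheory GRing.Theory Num.Theory.
Set Implicit Arguments.
Unset Strict Implicit.
Unset Printing Implicit Defensive.
Local Open Scope ring_scope.

(**
  Let [Phi] be the fundamental matrix of the equation, mapping [(y_0, f_0 Δy_0)]
  to [(y_N, f_N Δy_N)], and let [A = adj M * Phi], a unimodular matrix of real
  polynomials in [lambda], with trace [D] and upper right entry [S].
  The eigenvalues for [[e^{i gamma} M | -I]] are the solutions of
  [D = 2 cos gamma], those for [S_K] the zeros of [S].

  Zeros of [S] are real by the Lagrange identity. At such a zero [A] is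
  triangular, so [|D| >= 2], and variation of constants gives [S' = A_11 G]
  with [G > 0]; hence the zeros are simple and the sign of [D] alternates along
  them. Adding a point near [-oo] and/or [+oo], according to the leading
  coefficients, yields nodes [x_0 < ... < x_N] with [(-1)^j D(x_j) >= 2].
  Therefore each [D - c] with [|c| <= 2] has its [N] roots distributed one per
  interval [[x_j, x_{j+1}]], which gives all the inequalities. At [D = ±2],
  where roots may be double, [D' = 0] exactly when [Phi = ±M], so that the
  multiplicity of a root is the dimension of the solution space.
*)

(** * Real polynomials *)

Section RealPolynomials.
Variable R : rcfType.

(** Composition with [- 'X] carries the behaviour at -oo to +oo; the quantity in the hypothesis is
    the leading coefficient of the composite. *)
Lemma poly_minfty_lt (p : {poly R}) (m : R) : 0 < (-1) ^+ (size p).-1 * lead_coef p ->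
  exists x, x < m /\ 0 < p.[x].
Proof.
move=> h; have hs : size (- 'X : {poly R}) = 2%N by rewrite size_polyN size_polyX.
have : 0 < lead_coef (p \Po - 'X).
  by rewrite lead_coef_comp ?hs // lead_coefN lead_coefX mulrC.
move=> h1; have [n hn] := poly_pinfty_gt_lc h1.
pose y := Num.max n (1 - m); exists (- y); split.
  have : 1 - m <= y by rewrite le_max lexx orbT.
  by lra.
have := hn y; rewrite le_max lexx => /(_ isT) hy.
by move: (lt_le_trans h1 hy); rewrite horner_comp !hornerE.
Qed.

Lemma poly_pinfty_gt (p : {poly R}) (m : R) : 0 < lead_coef p -> exists x, m < x /\ 0 < p.[x].
Proof.
move=> h1; have [n hn] := poly_pinfty_gt_lc h1.
pose y := Num.max n (1 + m); exists y; split.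
  have : 1 + m <= y by rewrite le_max lexx orbT.
  by lra.
have := hn y; rewrite le_max lexx => /(_ isT) hy.
exact: lt_le_trans h1 hy.
Qed.

(* If [x 1] is the only root of [p] in [[x 0, x 1]], then after division by
   ['X - (x 1)%:P] the quotient still has the weak sign required at [x 1]:
   otherwise it would have a root in between. *)
Lemma weakly_alternating_roots (n : nat) (p : {poly R}) (x : nat -> R) :
  (forall j, (j < n)%N -> x j < x j.+1) ->
  (forall j, (j <= n)%N -> 0 <= (-1) ^+ j * p.[x j]) ->
  exists r : nat -> R,
    (forall j, (j < n)%N -> x j <= r j <= x j.+1) /\
    \prod_(j < n) ('X - (r j)%:P) %| p.
Proof.
elim: n p x => [|n IHn] p x hx hp.
  by exists x; split=> //; rewrite big_ord0 dvd1p.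
have hx01 : x 0%N < x 1%N by exact: hx.
have p0 : 0 <= p.[x 0%N] by have := hp 0%N isT; rewrite expr0 mul1r.
have p1 : p.[x 1%N] <= 0 by have := hp 1%N isT; rewrite expr1 mulN1r oppr_ge0.
have xlt j : (j < n)%N -> x 1%N < x j.+2.
  elim: j => [|j IHj] hj; first exact: hx.
  by apply: lt_trans (IHj (ltnW hj)) _; exact: hx.
(* Splitting off a root [r] of the first interval leaves [- p'] on the shifted nodes. From [x 2] on,
   the positive factor [x j - r] transfers the signs of [p]; only the sign at [x 1] has to be
   supplied. *)
have key r p' : x 0%N <= r <= x 1%N -> p = p' * ('X - r%:P) -> p'.[x 1%N] <= 0 ->
    exists r : nat -> R, (forall j, (j < n.+1)%N -> x j <= r j <= x j.+1) /\
    \prod_(j < n.+1) ('X - (r j)%:P) %| p.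
  move=> hr pE p'1.
  have [||r' [hr' dr']] := IHn (- p') (fun j => x j.+1).
  - by move=> j hj; apply: hx.
  - case=> [|j] hj; first by rewrite expr0 mul1r hornerN oppr_ge0.
    have := hp j.+2 hj; rewrite pE hornerM hornerXsubC hornerN.
    have hpos : 0 < x j.+2 - r by have := xlt j hj; case/andP: hr; lra.
    rewrite (exprS _ j.+1) (_ : _ * _ = (-1) ^+ j.+1 * - p'.[x j.+2] * (x j.+2 - r)); last by ring.
    by rewrite pmulr_lge0.
  exists (fun j => if j is j'.+1 then r' j' else r); split.
    by case=> [|j] hj //=; exact: hr'.
  by rewrite big_ord_recl pE mulrC dvdp_mul2r ?polyXsubC_eq0 //= -dvdpNr.
(* A root strictly left of [x 1] makes [x 1 - r] positive, so the sign at [x 1] is inherited from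
   [p]. *)
have [[r /andP[hr /andP[h0r hr1]]]|nor] :=
    pselect (exists r, root p r && ((x 0%N <= r) && (r < x 1%N))).
  have /factor_theorem [p' pE] := hr.
  apply: (key r p') => //; first by rewrite h0r ltW.
  by move: p1; rewrite pE hornerM hornerXsubC pmulr_lle0 // subr_gt0.
have pp0 : 0 < p.[x 0%N].
  rewrite lt_neqAle p0 andbT eq_sym; apply/negP => r0; apply: nor; exists (x 0%N).
  by rewrite /root r0 lexx.
have r1 : root p (x 1%N).
  have [|r] := @polyrcf.poly_ivt _ p _ _ (ltW hx01); first by rewrite pmulr_rle0.
  rewrite in_itv /= => /andP[h0r hr1] hr.
  have [e|ne] := eqVneq r (x 1%N); first by rewrite -e.
  by exfalso; apply: nor; exists r; rewrite hr h0r lt_neqAle ne.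
have /factor_theorem [p' pE] := r1.
apply: (key (x 1%N) p') => //; first by rewrite lexx ltW.
rewrite leNgt; apply/negP => p'1.
have p'0 : p'.[x 0%N] < 0.
  by move: pp0; rewrite pE hornerM hornerXsubC nmulr_lgt0 // subr_lt0.
have [|r] := @poly_ivtoo _ p' _ _ (ltW hx01); first by rewrite pmulr_llt0.
rewrite in_itv /= => /andP[h0r hr1] hr.
by apply: nor; exists r; rewrite pE rootM hr (ltW h0r) hr1.
Qed.

(** With one factor ['X - z] split off, the derivative at [z] is [L] times the remaining product,
    which vanishes exactly when [z] occurs again. *)
Lemma deriv_prod_XsubC_eq0 (L z : R) (s : seq R) : L != 0 -> z \in s ->
  ((L *: \prod_(r <- s) ('X - r%:P))^`().[z] == 0) = (1 < count_mem z s)%N.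
Proof.
move=> L0 zs; rewrite (perm_big _ (perm_to_rem zs)) big_cons /=.
rewrite derivZ derivM derivXsubC hornerZ !hornerE subrr mul0r addr0.
rewrite mulf_eq0 (negPf L0) /= -/(root _ z) root_prod_XsubC.
have /permP /(_ (pred1 z)) -> := perm_to_rem zs.
by rewrite /= eqxx -has_pred1 has_count.
Qed.

(** The derivative at a root is the product of its differences to the other roots, and
    [size s - 1 - j] of these are negative. *)
Lemma deriv_prod_XsubC_sign (s : seq R) (j : nat) : sorted <%R s -> (j < size s)%N ->
  0 < (-1) ^+ (size s).-1 * ((-1) ^+ j * (\prod_(r <- s) ('X - r%:P))^`().[nth 0 s j]).
Proof.
elim: s j => // x s IHs j hs hj.
have hxs : all (> x) s by apply: order_path_min hs; exact: lt_trans.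
rewrite big_cons derivM derivXsubC mul1r.
case: j hj => [|j] hj.
  rewrite /= expr0 mul1r !hornerE subrr mul0r addr0.
  elim: s hxs {IHs hs hj} => [_|y s IH]; first by rewrite big_nil expr0 mul1r hornerC.
  move=> /= /andP[hy /IH h]; rewrite big_cons hornerM hornerXsubC exprS.
  rewrite (_ : _ * _ = (y - x) * ((-1) ^+ size s * (\prod_(r <- s) ('X - r%:P)).[x])); last by ring.
  by rewrite mulr_gt0 // subr_gt0.
have hj' : (j < size s)%N by [].
rewrite [nth _ _ _]/=; set y := nth 0 s j.
have ys : y \in s by exact: mem_nth.
have hxy : 0 < y - x by rewrite subr_gt0; exact: (allP hxs).
have ry : (\prod_(r <- s) ('X - r%:P)).[y] = 0 by apply/eqP; rewrite -/(root _ _) root_prod_XsubC.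
rewrite hornerD hornerM hornerXsubC ry add0r /=.
have := IHs j (path_sorted hs) hj'; rewrite -/y.
case: (size s) hj' => // m _ /= h.
rewrite !exprS (_ : _ * _ =
 (y - x) * ((-1) ^+ m * ((-1) ^+ j * (\prod_(r <- s) ('X - r%:P))^`().[y]))); last by ring.
exact: mulr_gt0.
Qed.

(** Equal entries of a sorted list are adjacent, so a third copy would sit two places after the
    first. *)
Lemma count_mem_le2 (s : seq R) (z : R) : sorted <=%R s ->
  (forall j, (j.+2 < size s)%N -> nth 0 s j < nth 0 s j.+2) -> (count_mem z s <= 2)%N.
Proof.
elim: s => [|x [|y t] IH] // hs hj; first by rewrite /= addn0; case: (_ == _).
have [xz|xz] := eqVneq x z; last first.
  rewrite /= (negPf xz) add0n; apply: IH; first exact: path_sorted hs.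
  by move=> j h; have := hj j.+1; apply.
suff -> : count_mem z (x :: y :: t) = (1 + ((y == z) + 0))%N by case: (_ == _).
rewrite /= xz eqxx; congr (_ + (_ + _))%N.
case: t hs hj {IH} => // u t hs hj.
have hu := hj 0%N isT; rewrite /= in hu.
apply/eqP; rewrite -leqn0 leqNgt -has_count has_pred1.
apply/negP => zin.
have hsu : sorted <=%R (u :: t) by move: hs => /= /and3P[].
have : all (>= u) (u :: t) by rewrite /= lexx (order_path_min le_trans hsu).
by move=> /allP /(_ z zin); rewrite -xz leNgt hu.
Qed.

Lemma dvdp_prod_XsubC_eq (n : nat) (p : {poly R}) (r : nat -> R) : size p = n.+1 ->
  \prod_(j < n) ('X - (r j)%:P) %| p ->
  p = lead_coef p *: \prod_(z <- mkseq r n) ('X - z%:P).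
Proof.
move=> sp dv.
have E : \prod_(z <- mkseq r n) ('X - z%:P) = \prod_(j < n) ('X - (r j)%:P).
  by rewrite /mkseq big_map -(big_mkord xpredT (fun j => 'X - (r j)%:P)) /index_iota subn0.
have p0 : p != 0 by rewrite -size_poly_gt0 sp.
have : \prod_(z <- mkseq r n) ('X - z%:P) %= p.
  by rewrite -dvdp_size_eqp ?E // -E size_prod_XsubC size_mkseq sp.
move=> /eqp_eq; rewrite (eqP (monic_prod_XsubC _ _ _)) scale1r => ->.
by [].
Qed.

Lemma lt_image_sorted (n : nat) (r : nat -> R) :
  (forall j, (j.+1 < n)%N -> r j < r j.+1) -> sorted <%R (mkseq r n).
Proof.
move=> h; apply/(sortedP 0) => i; rewrite size_mkseq => hi.
by rewrite !nth_mkseq ?h // ltnW.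
Qed.

Lemma le_image_sorted (n : nat) (r : nat -> R) :
  (forall j, (j.+1 < n)%N -> r j <= r j.+1) -> sorted <=%R (mkseq r n).
Proof.
move=> h; apply/(sortedP 0) => i; rewrite size_mkseq => hi.
by rewrite !nth_mkseq ?h // ltnW.
Qed.

End RealPolynomials.

(** * Solutions as polynomials in the spectral parameter *)

Section SolutionPolynomials.
Variables (R : realType) (f q w : nat -> R).

(* [(y_n, f_n Δy_n)] as polynomials in the spectral parameter, for the
   solution with initial data [y_0 = u0], [f_0 Δy_0 = v0]. *)
Fixpoint sol_pair (u0 v0 : R) (n : nat) : {poly R} * {poly R} :=
  if n is n'.+1 then
    let: (u, v) := sol_pair u0 v0 n' in
    let u' := u + (f n')^-1 *: v in
    (u', v + ((q n)%:P - w n *: 'X) * u')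
  else (u0%:P, v0%:P).

Definition solU u0 v0 n := (sol_pair u0 v0 n).1.
Definition solV u0 v0 n := (sol_pair u0 v0 n).2.

Lemma solUS u0 v0 n : solU u0 v0 n.+1 = solU u0 v0 n + (f n)^-1 *: solV u0 v0 n.
Proof. by rewrite /solU /solV /=; case: (sol_pair _ _ _). Qed.

Lemma solVS u0 v0 n : solV u0 v0 n.+1 =
  solV u0 v0 n + ((q n.+1)%:P - w n.+1 *: 'X) * solU u0 v0 n.+1.
Proof. by rewrite solUS /solU /solV /=; case: (sol_pair _ _ _). Qed.

Local Notation phi := (solU 1 0).
Local Notation phi' := (solV 1 0).
Local Notation psi := (solU 0 1).
Local Notation psi' := (solV 0 1).

(** Each recurrence adds a multiple of one component to the other, a shear of determinant 1. *)
Lemma wronskian n : phi n * psi' n - psi n * phi' n = 1.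
Proof.
elim: n => [|n IHn]; first by rewrite /solU /solV /= mulr1 mul0r subr0.
by rewrite !solVS !solUS -IHn -!mul_polyC; ring.
Qed.

Definition gram (x y : nat -> {poly R}) n : {poly R} :=
  \sum_(k < n) (w k.+1) *: (x k.+1 * y k.+1).

Lemma gramS x y n : gram x y n.+1 = gram x y n + (w n.+1) *: (x n.+1 * y n.+1).
Proof. by rewrite /gram big_ord_recr. Qed.

(* Variation of constants: with [Phi] the fundamental matrix,
   [Phi' = Phi * [[G(phi,psi), G(psi,psi)], [-G(phi,phi), -G(phi,psi)]]]. *)
Lemma deriv_fundamental n :
  [/\ (phi n)^`() = phi n * gram phi psi n - psi n * gram phi phi n,
      (phi' n)^`() = phi' n * gram phi psi n - psi' n * gram phi phi n,
      (psi n)^`() = phi n * gram psi psi n - psi n * gram phi psi n &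
      (psi' n)^`() = phi' n * gram psi psi n - psi' n * gram phi psi n].
Proof.
elim: n => [|n [h1 h2 h3 h4]].
  by rewrite /gram !big_ord0 /solU /solV /= !derivC; split; ring.
have W := wronskian n.+1.
have d1 : (phi n.+1)^`() = phi n.+1 * gram phi psi n - psi n.+1 * gram phi phi n.
  by rewrite !solUS derivD derivZ h1 h2 -!mul_polyC; ring.
have d3 : (psi n.+1)^`() = phi n.+1 * gram psi psi n - psi n.+1 * gram phi psi n.
  by rewrite !solUS derivD derivZ h3 h4 -!mul_polyC; ring.
have d2 : (phi' n.+1)^`() = phi' n.+1 * gram phi psi n - psi' n.+1 * gram phi phi n
    - (w n.+1)%:P * phi n.+1.
  rewrite !solVS derivD derivM d1 h2 derivB derivC derivZ derivX -!mul_polyC; ring.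
have d4 : (psi' n.+1)^`() = phi' n.+1 * gram psi psi n - psi' n.+1 * gram phi psi n
    - (w n.+1)%:P * psi n.+1.
  rewrite !solVS derivD derivM d3 h4 derivB derivC derivZ derivX -!mul_polyC; ring.
rewrite d1 d2 d3 d4 !gramS -!mul_polyC.
move: W; set a := phi n.+1; set b := phi' n.+1; set c := psi n.+1; set d := psi' n.+1 => W.
split; [by ring| |by ring|].
(* The stray terms [w phi] and [w psi] are multiplied by the Wronskian, which is 1, to take the
   required form. *)
- rewrite -[X in _ - X]mulr1 -W; ring.
- rewrite -[X in _ - X]mulr1 -W; ring.
Qed.

(** Only [- w *: 'X] raises the degree: each step multiplies the top coefficient by [- w / f],
    starting from [y_1 = u0 + v0 / f_0]. The sizes are only bounded, since these coefficients may
    vanish. *)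
Lemma sol_coef u0 v0 n :
  [/\ (size (solU u0 v0 n.+1) <= n.+1)%N, (size (solV u0 v0 n.+1) <= n.+2)%N,
   (solU u0 v0 n.+1)`_n = (u0 + v0 / f 0%N) * \prod_(k < n) (- w k.+1 / f k.+1) &
   (solV u0 v0 n.+1)`_n.+1 = - w n.+1 * (solU u0 v0 n.+1)`_n].
Proof.
have coefV m : (size (solU u0 v0 m.+1) <= m.+1)%N -> (size (solV u0 v0 m) <= m.+1)%N ->
   (size (solV u0 v0 m.+1) <= m.+2)%N /\
   (solV u0 v0 m.+1)`_m.+1 = - w m.+1 * (solU u0 v0 m.+1)`_m.
  move=> hU hV; rewrite solVS; set U := solU _ _ _ in hU *; set V := solV _ _ _ in hV *.
  have E : ((q m.+1)%:P - w m.+1 *: 'X) * U = (q m.+1) *: U - w m.+1 *: (U * 'X).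
    by rewrite mulrBl mul_polyC -scalerAl [U * _]mulrC.
  have sUX : (size (U * 'X)%R <= m.+2)%N.
    by apply: leq_trans (size_polyMleq _ _) _; rewrite size_polyX addn2 /= ltnS.
  rewrite E; split.
    apply: leq_trans (size_polyD _ _) _; rewrite geq_max (leq_trans hV) //=.
    apply: leq_trans (size_polyD _ _) _; rewrite geq_max size_polyN.
    by rewrite !(leq_trans (size_scale_leq _ _)) // leqW.
  rewrite !coefE /= (nth_default _ hV) (nth_default _ hU); ring.
elim: n => [|n [sU sV cU cV]].
  have s1 : (size (solU u0 v0 1) <= 1)%N.
    rewrite solUS /solU /solV /= -[_ *: _]mul_polyC -polyCM -polyCD; exact: size_polyC_leq1.
  have [s2 c2] := coefV 0%N s1 (size_polyC_leq1 _).
  split=> //; rewrite big_ord0 mulr1 solUS /solU /solV /= -mul_polyC -polyCM -polyCD coefC /=; ring.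
have s1 : (size (solU u0 v0 n.+2) <= n.+2)%N.
  rewrite solUS; apply: leq_trans (size_polyD _ _) _; rewrite geq_max leqW //=.
  exact: leq_trans (size_scale_leq _ _) _.
have [s2 c2] := coefV n.+1 s1 sV.
split=> //; rewrite solUS coefD coefZ cV cU (nth_default _ sU) big_ord_recr /=; ring.
Qed.

End SolutionPolynomials.

(** * Multiplicities *)

Lemma sum_ord2 (V : nmodType) (F : 'I_2 -> V) : \sum_i F i = F 0 + F 1.
Proof. by rewrite big_ord_recl big_ord1; congr (_ + F _); exact: val_inj. Qed.

Section Multiplicity.
Variables (R : realType) (N : nat) (f q w : nat -> R).
Hypothesis f_neq0 : forall n, (n <= N)%N -> f n != 0.
Local Notation C := R[i].
Local Notation "x %:C" := (real_complex R x).
Local Notation phi := (solU f q w 1 0).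
Local Notation phi' := (solV f q w 1 0).
Local Notation psi := (solU f q w 0 1).
Local Notation psi' := (solV f q w 0 1).

(** Eigenvalue lists must account for every complex number, so real polynomials are evaluated off
    the real line too. *)
Definition ceval (z : C) (p : {poly R}) : C := (map_poly (real_complex R) p).[z].

Lemma cevalD z p1 p2 : ceval z (p1 + p2) = ceval z p1 + ceval z p2.
Proof. by rewrite /ceval rmorphD hornerD. Qed.

Lemma cevalB z p1 p2 : ceval z (p1 - p2) = ceval z p1 - ceval z p2.
Proof. by rewrite /ceval rmorphB !hornerE. Qed.

Lemma cevalM z p1 p2 : ceval z (p1 * p2) = ceval z p1 * ceval z p2.
Proof. by rewrite /ceval rmorphM hornerM. Qed.

Lemma cevalC z c : ceval z c%:P = c%:C.
Proof. by rewrite /ceval map_polyC hornerC. Qed.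

Lemma cevalZ z c p : ceval z (c *: p) = c%:C * ceval z p.
Proof. by rewrite -mul_polyC cevalM cevalC. Qed.

Lemma cevalX z : ceval z 'X = z.
Proof. by rewrite /ceval map_polyX hornerX. Qed.

Lemma ceval_real x p : ceval x%:C p = (p.[x])%:C.
Proof. exact: horner_map. Qed.

Lemma ceval_solUS z u0 v0 n : ceval z (solU f q w u0 v0 n.+1) =
  ceval z (solU f q w u0 v0 n) + (f n)^-1%:C * ceval z (solV f q w u0 v0 n).
Proof. by rewrite solUS cevalD cevalZ. Qed.

Lemma ceval_solVS z u0 v0 n : ceval z (solV f q w u0 v0 n.+1) =
  ceval z (solV f q w u0 v0 n) +
  ((q n.+1)%:C - z * (w n.+1)%:C) * ceval z (solU f q w u0 v0 n.+1).
Proof. by rewrite solVS cevalD cevalM cevalB cevalC cevalZ cevalX [z * _]mulrC. Qed.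

Lemma ceval_solV z u0 v0 n : (n <= N)%N -> ceval z (solV f q w u0 v0 n) =
  (f n)%:C * (ceval z (solU f q w u0 v0 n.+1) - ceval z (solU f q w u0 v0 n)).
Proof.
move=> hn; rewrite ceval_solUS addrAC subrr add0r mulrA -rmorphM mulfV ?f_neq0 //.
by rewrite rmorph1 mul1r.
Qed.

Variables (A B : 'M[C]_2).

Lemma sl_residual_ext lam c Y1 Y2 : (forall i, (i < N.+2)%N -> Y1 i = Y2 i) ->
  sl_residual R N f q w A B lam c Y1 = sl_residual R N f q w A B lam c Y2.
Proof.
move=> h; rewrite /sl_residual; case: ifP => hc.
  by rewrite /= !h // ltnS ?ltnS // ltnW // ?ltnW.
by rewrite !h // ltnW.
Qed.

Lemma sl_residual_sum lam c (I : Type) (r : seq I) (a : I -> C) (Z : I -> nat -> C) :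
  sl_residual R N f q w A B lam c (fun i => \sum_(k <- r) a k * Z k i) =
  \sum_(k <- r) a k * sl_residual R N f q w A B lam c (Z k).
Proof.
elim: r => [|x r IHr].
  rewrite !big_nil /sl_residual; case: ifP => _; rewrite !big_nil; ring.
rewrite big_cons -IHr /sl_residual; case: ifP => _; rewrite !big_cons; ring.
Qed.

Lemma mul_sl_matrix lam (y : 'rV[C]_N.+2) c :
  (y *m sl_matrix R N f q w A B lam) 0 c =
  sl_residual R N f q w A B lam c (fun k => y 0 (inord k)).
Proof.
rewrite mxE; under eq_bigr do rewrite mxE.
rewrite -sl_residual_sum; apply: sl_residual_ext => i hi.
rewrite (bigD1 (inord i)) //= inordK // eqxx mulr1 big1 ?addr0 // => k hk.
rewrite (_ : (i == k :> nat) = false) ?mulr0 //.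
by apply/negP => /eqP e; move: hk; rewrite -val_eqE /= inordK // e eqxx.
Qed.

(** The transpose of [A + B Phi], so that a row vector of initial data acts from the left. *)
Definition bc_matrix (z : C) : 'M[C]_2 :=
  \matrix_(i, c) (A c i
    + B c 0 * ceval z (if i == 0 then phi N else psi N)
    + B c 1 * ceval z (if i == 0 then phi' N else psi' N)).

Definition fund_matrix (z : C) : 'M[C]_(2, N.+2) :=
  \matrix_(i, k) ceval z (if i == 0 then phi k else psi k).

Lemma mul_fund_matrix (x : 'rV[C]_2) z n : (n < N.+2)%N ->
  (x *m fund_matrix z) 0 (inord n) = x 0 0 * ceval z (phi n) + x 0 1 * ceval z (psi n).
Proof. by move=> hn; rewrite mxE sum_ord2 !mxE /= inordK. Qed.

Lemma residual_fund_matrix (x : 'rV[C]_2) z (c : 'I_N.+2) :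
  sl_residual R N f q w A B z c (fun k => (x *m fund_matrix z) 0 (inord k)) =
  if (c < N)%N then 0 else (x *m bc_matrix z) 0 (if c == N :> nat then 0 else 1).
Proof.
pose Y k := x 0 0 * ceval z (phi k) + x 0 1 * ceval z (psi k).
rewrite (@sl_residual_ext _ _ _ Y); last by move=> i hi; rewrite mul_fund_matrix.
have dY n : (n <= N)%N -> (f n)%:C * (Y n.+1 - Y n) =
    x 0 0 * ceval z (phi' n) + x 0 1 * ceval z (psi' n).
  by move=> hn; rewrite !ceval_solV // /Y; ring.
rewrite /sl_residual; case: ifP => hc /=.
  rewrite (dY c.+1) //.
  rewrite (dY c); last by rewrite ltnW.
  rewrite (ceval_solVS z 1 0).
  rewrite (ceval_solVS z 0 1) /Y.
  by ring.
rewrite (dY 0%N) // (dY N) // /Y /solU /solV /= !cevalC -!/(solU _ _ _ _ _ _).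
set i := if _ then _ else _; rewrite mxE sum_ord2 !mxE /=.
by rewrite rmorph1 rmorph0; ring.
Qed.

(** [y_0] and [y_1] already determine the coefficients, because [phi_0 = 1], [psi_0 = 0] and
    [psi_1 = 1 / f_0]. *)
Lemma row_free_fund_matrix z : row_free (fund_matrix z).
Proof.
rewrite -kermx_eq0; apply/rowV0P => x /sub_kermxP hx.
have h n : (n < N.+2)%N -> x 0 0 * ceval z (phi n) + x 0 1 * ceval z (psi n) = 0.
  by move=> hn; rewrite -mul_fund_matrix // hx mxE.
have x0 : x 0 0 = 0.
  by have := h 0%N isT; rewrite /solU /= !cevalC rmorph1 rmorph0 mulr1 mulr0 addr0.
have x1 : x 0 1 = 0.
  have := h 1%N isT; rewrite x0 mul0r add0r ceval_solUS /solU /solV /= !cevalC.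
  rewrite rmorph1 rmorph0 mulr1 add0r => /eqP; rewrite mulf_eq0 => /orP[/eqP//|].
  by rewrite fmorph_eq0 invr_eq0 (negPf (f_neq0 _)).
apply/rowP => i; rewrite mxE; case: i => [[|[|i]] hi] //.
  by rewrite -[RHS]x0; congr (x _ _); exact: val_inj.
by rewrite -[RHS]x1; congr (x _ _); exact: val_inj.
Qed.

Lemma solution_in_fund_matrix (y : 'rV[C]_N.+2) z :
  (forall c : 'I_N.+2, (c < N)%N ->
     sl_residual R N f q w A B z c (fun k => y 0 (inord k)) = 0) ->
  exists x, y = x *m fund_matrix z.
Proof.
move=> hy; pose Y k := y 0 (inord k).
pose F n := (f n)%:C * (Y n.+1 - Y n).
pose x : 'rV[C]_2 := \row_i (if i == 0 then Y 0%N else F 0%N).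
have YS n : (n <= N)%N -> Y n.+1 = Y n + (f n)^-1%:C * F n.
  move=> hn; rewrite /F mulrA -rmorphM mulVf ?f_neq0 // rmorph1 mul1r; ring.
have FS n : (n < N)%N -> F n.+1 = F n + ((q n.+1)%:C - z * (w n.+1)%:C) * Y n.+1.
  move=> hn; have hn2 : (n < N.+2)%N by rewrite ltnW // ltnW.
  have := hy (Ordinal hn2) hn; rewrite /sl_residual /= hn -/(Y n) -/(Y n.+1) -/(Y n.+2).
  rewrite -/(F n) -/(F n.+1) => h; apply/eqP; rewrite -subr_eq0 -oppr_eq0 -h; apply/eqP; ring.
have key n : (n <= N)%N ->
    Y n = x 0 0 * ceval z (phi n) + x 0 1 * ceval z (psi n) /\
    F n = x 0 0 * ceval z (phi' n) + x 0 1 * ceval z (psi' n).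
  elim: n => [_|n IHn hn].
    rewrite /solU /solV /= !cevalC rmorph1 rmorph0 !mxE /=; split; ring.
  have [h1 h2] := IHn (ltnW hn).
  have hY : Y n.+1 = x 0 0 * ceval z (phi n.+1) + x 0 1 * ceval z (psi n.+1).
    rewrite (YS n (ltnW hn)) h1 h2 !ceval_solUS; ring.
  split=> //; rewrite (FS n hn) h2 hY (ceval_solVS z 1 0) (ceval_solVS z 0 1); ring.
exists x; apply/rowP => k; have hk := ltn_ord k.
rewrite -[k]inord_val mul_fund_matrix // -/(Y k).
move: hk; rewrite ltnS leq_eqVlt => /orP[/eqP ->|]; last by rewrite ltnS => /key[].
(* The induction stops at index [N]; [y_{N+1}] is recovered from [Y N] and [F N]. *)
have [h1 h2] := key N (leqnn N).
rewrite YS // h1 h2 !ceval_solUS; ring.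
Qed.

(** The injective map [fund_matrix] carries the kernel of [bc_matrix] onto the solution space, so a
    2x2 kernel gives the multiplicity. *)
Lemma sl_multE z : sl_mult R N f q w A B z = \rank (kermx (bc_matrix z)).
Proof.
rewrite /sl_mult -(mxrankMfree _ (row_free_fund_matrix z)).
have bc0 (x : 'rV_2) : x *m fund_matrix z *m sl_matrix R N f q w A B z = 0 <->
    x *m bc_matrix z = 0.
  split=> h; last first.
    apply/rowP => c; rewrite mul_sl_matrix residual_fund_matrix h !mxE.
    by case: ifP.
  apply/rowP => i; rewrite [RHS]mxE.
  have hN : (N < N.+2)%N by [].
  case: i => [[|[|i]] hi] //.
    have := congr1 (fun u : 'rV_N.+2 => u 0 (Ordinal hN)) h.
    rewrite mul_sl_matrix residual_fund_matrix /= ltnn eqxx [RHS]mxE => e.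
    by rewrite (_ : Ordinal hi = 0) //; exact: val_inj.
  have := congr1 (fun u : 'rV_N.+2 => u 0 ord_max) h.
  rewrite mul_sl_matrix residual_fund_matrix /= ltnNge leqnSn /= gtn_eqF // [RHS]mxE => e.
  by rewrite (_ : Ordinal hi = 1) //; exact: val_inj.
apply/eqP; rewrite eqn_leq; apply/andP; split; apply: mxrankS.
  apply/rV_subP => y /sub_kermxP hy.
  have [|x yx] := @solution_in_fund_matrix y z.
    by move=> c _; rewrite -mul_sl_matrix hy mxE.
  rewrite yx; apply: submxMr; apply/sub_kermxP/bc0.
  by rewrite -yx.
apply/sub_kermxP; apply/row_matrixP => i; rewrite 2!row_mul row0.
by apply: (proj2 (bc0 _)); apply/sub_kermxP; exact: row_sub.
Qed.

End Multiplicity.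

Lemma det_mx22 (F : comRingType) (A : 'M[F]_2) : \det A = A 0 0 * A 1 1 - A 0 1 * A 1 0.
Proof.
rewrite (expand_det_row _ 0) sum_ord2 /cofactor !det_mx11 !mxE /=.
rewrite (_ : lift 1 0 = 0); last exact/val_inj.
rewrite (_ : lift 0 0 = 1); last exact/val_inj.
by rewrite expr0 expr1; ring.
Qed.

Lemma mxrank_ker22 (F : fieldType) (A : 'M[F]_2) :
  \rank (kermx A) = if \det A == 0 then (if A == 0 then 2 else 1) else 0%N.
Proof.
rewrite mxrank_ker; have [->|A0] := eqVneq A 0.
  by rewrite mxrank0 det0 // eqxx.
have r0 : \rank A != 0%N by rewrite mxrank_eq0.
have rU : (\rank A == 2)%N = (\det A != 0).
  by rewrite -unitfE -[_ \is a _]/(A \in unitmx) -row_full_unit.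
have r2 := rank_leq_row A.
case: ifP rU => _ /= /eqP; lia.
Qed.

(** A sorted list is determined by its counts, so exhibiting any eigenvalue list computes the chosen
    spectrum. *)
Lemma sl_spectrumE (R : realType) N (f q w : nat -> R) A B s :
  sl_eigen_list R N f q w A B s -> sl_spectrum R N f q w A B = s.
Proof.
move=> hs; rewrite /sl_spectrum; case: pselect => [H|[]]; last by exists s.
case: (cid H) => t [t1 t2] /=; case: hs => s1 s2.
apply: le_sorted_eq => //; apply/allP => x _ /=; apply/eqP.
have := t2 (real_complex R x); rewrite s2 => e.
by rewrite -(eq_count (a1 := fun y => real_complex R y == real_complex R x)) -?e;
  [apply: eq_count|] => y /=; rewrite (inj_eq (@complexI R)).
Qed.

(** * The discriminant *)

Section Discriminant.
Variables (R : realType) (N : nat) (f q w : nat -> R) (M : 'M[R]_2).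
Hypothesis N_ge2 : (2 <= N)%N.
Hypothesis f_neq0 : forall n, (n <= N)%N -> f n != 0.
Hypothesis w_gt0 : forall n, (1 <= n <= N)%N -> 0 < w n.
Hypothesis detM : \det M = 1.
Local Notation C := R[i].
Local Notation "x %:C" := (real_complex R x).
Local Notation phi := (solU f q w 1 0).
Local Notation phi' := (solV f q w 1 0).
Local Notation psi := (solU f q w 0 1).
Local Notation psi' := (solV f q w 0 1).

(* The entries of [adj M * Phi_N]. *)
Definition discA : {poly R} := M 1 1 *: phi N - M 0 1 *: phi' N.
Definition discS : {poly R} := M 1 1 *: psi N - M 0 1 *: psi' N.
Definition discC : {poly R} := M 0 0 *: phi' N - M 1 0 *: phi N.
Definition discD : {poly R} := M 0 0 *: psi' N - M 1 0 *: psi N.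
Definition disc : {poly R} := discA + discD.

Lemma detM_entries : M 0 0 * M 1 1 - M 0 1 * M 1 0 = 1.
Proof. by rewrite -det_mx22. Qed.

Lemma horner_wronskian n t :
  (phi n).[t] * (psi' n).[t] - (psi n).[t] * (phi' n).[t] = 1.
Proof. by rewrite -!hornerM -hornerN -hornerD wronskian hornerC. Qed.

(** The determinant of [adj M * Phi_N] is [det M] times the Wronskian. *)
Lemma disc_unimodular t : discA.[t] * discD.[t] - discS.[t] * discC.[t] = 1.
Proof.
rewrite /discA /discD /discS /discC !hornerE.
transitivity ((M 0 0 * M 1 1 - M 0 1 * M 1 0) *
  ((phi N).[t] * (psi' N).[t] - (psi N).[t] * (phi' N).[t])); first by ring.
by rewrite detM_entries horner_wronskian mulr1.
Qed.

Local Notation Gff := (gram w phi phi N).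
Local Notation Gfs := (gram w phi psi N).
Local Notation Gss := (gram w psi psi N).

Lemma deriv_discS : discS^`() = discA * Gss - discS * Gfs.
Proof.
have [h1 h2 h3 h4] := deriv_fundamental f q w N.
rewrite /discS derivB !derivZ h3 h4 /discA -!mul_polyC; ring.
Qed.

Lemma deriv_disc : disc^`() = (discA - discD) * Gfs + discC * Gss - discS * Gff.
Proof.
have [h1 h2 h3 h4] := deriv_fundamental f q w N.
rewrite /disc /discA /discD derivD !derivB !derivZ h1 h2 h3 h4 /discC /discS -!mul_polyC; ring.
Qed.

Lemma horner_deriv_discS t :
  discS^`().[t] = discA.[t] * Gss.[t] - discS.[t] * Gfs.[t].
Proof. by rewrite deriv_discS; move: discA discS Gss Gfs => a b c d; rewrite !hornerE. Qed.

Lemma horner_deriv_disc t : disc^`().[t] =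
  (discA.[t] - discD.[t]) * Gfs.[t] + discC.[t] * Gss.[t] - discS.[t] * Gff.[t].
Proof.
by rewrite deriv_disc; move: discA discD discC discS Gff Gfs Gss => *; rewrite !hornerE.
Qed.

Lemma horner_gram x y n t :
  (gram w x y n).[t] = \sum_(k < n) w k.+1 * ((x k.+1).[t] * (y k.+1).[t]).
Proof. by rewrite /gram horner_sum; apply: eq_bigr => k _; rewrite !hornerE. Qed.

Lemma horner_solUS u0 v0 n t : (solU f q w u0 v0 n.+1).[t] =
  (solU f q w u0 v0 n).[t] + (f n)^-1 * (solV f q w u0 v0 n).[t].
Proof. by rewrite solUS hornerD hornerZ. Qed.

Lemma weight_gt0 (k : 'I_N) : 0 < w k.+1.
Proof. by apply: w_gt0; rewrite /= ltn_ord. Qed.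

Lemma horner_psi1 t : (psi 1).[t] = (f 0%N)^-1.
Proof. by rewrite solUS /solU /solV /= !hornerE. Qed.

Lemma gram_psi_gt0 t : 0 < Gss.[t].
Proof.
have hN : (0 < N)%N by exact: ltnW.
rewrite horner_gram (bigD1 (Ordinal hN)) //=; apply: ltr_pwDl.
  rewrite mulr_gt0 ?w_gt0 ?hN // -expr2 horner_psi1 exprn_even_gt0 //=.
  by rewrite invr_eq0 f_neq0.
by apply: sumr_ge0 => k _; rewrite mulr_ge0 ?(ltW (weight_gt0 _)) // -expr2 sqr_ge0.
Qed.

(** At such a point the diagonal entries satisfy [a d = 1], whence [disc * S' = (a ^ 2 + 1) G] and
    [(a + d) ^ 2 = (a - d) ^ 2 + 4]. *)
Lemma disc_at_root_discS t : discS.[t] = 0 ->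
  0 < disc.[t] * discS^`().[t] /\ 4 <= disc.[t] ^+ 2.
Proof.
move=> S0; have := disc_unimodular t; have := gram_psi_gt0 t.
rewrite horner_deriv_discS /disc (hornerD discA discD) S0 !mul0r !subr0.
move: (discA.[t]) (discD.[t]) (Gss.[t]) => a d g g0 ad.
have h : 0 < (a + d) * a by rewrite mulrDl [d * a]mulrC ad; have := sqr_ge0 a; rewrite expr2; lra.
split; first by rewrite mulrA mulr_gt0.
have -> : (a + d) ^+ 2 = (a - d) ^+ 2 + 4 * (a * d) by ring.
rewrite ad mulr1.
by have := sqr_ge0 (a - d); lra.
Qed.

(* On [disc = ±2] the matrix [adj M * Phi_N] has a double eigenvalue, so
   [- discS * disc'] is a weighted sum of squares of a single solution. *)
Lemma deriv_disc_eq0 (e t : R) : e * e = 1 -> disc.[t] = 2 * e ->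
  (disc^`().[t] = 0) <-> [/\ (phi N).[t] = e * M 0 0, (psi N).[t] = e * M 0 1,
                             (phi' N).[t] = e * M 1 0 & (psi' N).[t] = e * M 1 1].
Proof.
move=> ee De; have dM := detM_entries; have uni := disc_unimodular t.
have dE := horner_deriv_disc t.
split=> [D0|[h1 h2 h3 h4]]; last first.
  have hA : discA.[t] = e by rewrite /discA !hornerE h1 h3 -[RHS]mulr1 -dM; ring.
  have hD : discD.[t] = e by rewrite /discD !hornerE h2 h4 -[RHS]mulr1 -dM; ring.
  have hS : discS.[t] = 0 by rewrite /discS !hornerE h2 h4; ring.
  have hC : discC.[t] = 0 by rewrite /discC !hornerE h1 h3; ring.
  by rewrite dE hA hD hS hC; ring.
have De' : discA.[t] + discD.[t] = 2 * e by rewrite -De /disc (hornerD discA discD).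
have S0 : discS.[t] = 0.
  apply/eqP; apply: contraT => S0.
  (* From [disc ^ 2 = 4] one gets [h ^ 2 = - S C], and [(S, - h)] is an eigenvector of
     [adj M * Phi_N] for the eigenvalue [e]; [y] below is the solution with these initial data. *)
  pose h := (discA.[t] - discD.[t]) / 2.
  have hh : h ^+ 2 = - (discS.[t] * discC.[t]).
    have -> : h ^+ 2 = ((discA.[t] + discD.[t]) ^+ 2 - 4 * (discA.[t] * discD.[t])) / 4.
      by rewrite /h; field.
    rewrite De' exprMn expr2 [e ^+ 2]expr2 ee.
    by have -> : discA.[t] * discD.[t] = 1 + discS.[t] * discC.[t]; [rewrite -uni; ring|field].
  pose y k := discS.[t] * (phi k).[t] - h * (psi k).[t].
  have sq : \sum_(k < N) w k.+1 * y k.+1 ^+ 2 = - (discS.[t] * disc^`().[t]).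
    have -> : - (discS.[t] * disc^`().[t]) =
      discS.[t] ^+ 2 * Gff.[t] - 2 * h * discS.[t] * Gfs.[t] + h ^+ 2 * Gss.[t].
      by rewrite hh dE /h; field.
    rewrite !horner_gram !mulr_sumr -sumrB -big_split /=.
    by apply: eq_bigr => k _; rewrite /y; ring.
  have y0 (k : 'I_N) : y k.+1 = 0.
    move: sq; rewrite D0 mulr0 oppr0 => /eqP.
    rewrite psumr_eq0; last by move=> i _; rewrite mulr_ge0 ?sqr_ge0 ?(ltW (weight_gt0 _)).
    move=> /allP /(_ k); rewrite mem_index_enum => /(_ isT) /=.
    by rewrite mulf_eq0 (gt_eqF (weight_gt0 k)) /= sqrf_eq0 => /eqP.
  (* As [N >= 2], both [y_1] and [y_2] vanish, hence so does [f_1 Δy_1]; the Wronskian at 1 then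
     forces [S = 0]. *)
  have hN : (0 < N)%N by exact: ltnW.
  have y1 := y0 (Ordinal hN); have y2 := y0 (Ordinal N_ge2).
  have v1 : discS.[t] * (phi' 1).[t] - h * (psi' 1).[t] = 0.
    have : y 2%N - y 1%N = (f 1%N)^-1 * (discS.[t] * (phi' 1).[t] - h * (psi' 1).[t]).
      by rewrite /y (horner_solUS 1 0 1) (horner_solUS 0 1 1); ring.
    rewrite y1 y2 subr0 => /esym/eqP; rewrite mulf_eq0 invr_eq0 (negPf (f_neq0 _)) //=.
    by move/eqP.
  rewrite -(negbTE S0); apply/eqP; rewrite -[LHS]mulr1 -(horner_wronskian 1 t).
  have -> : discS.[t] * ((phi 1).[t] * (psi' 1).[t] - (psi 1).[t] * (phi' 1).[t]) =
    y 1%N * (psi' 1).[t] - (psi 1).[t] * (discS.[t] * (phi' 1).[t] - h * (psi' 1).[t]).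
    by rewrite /y; ring.
  by rewrite y1 v1; ring.
(* Now [S = 0], so the diagonal entries have product 1 and sum [2 e]: both equal [e], and
   [disc' = 0] leaves [C G = 0]. *)
move: uni; rewrite S0 mul0r subr0 => uni.
have hA : discA.[t] = e.
  apply/eqP; rewrite -subr_eq0 -sqrf_eq0; apply/eqP.
  have -> : (discA.[t] - e) ^+ 2 = discA.[t] * (discA.[t] + discD.[t] - 2 * e)
     - (discA.[t] * discD.[t]) + e * e by ring.
  by rewrite De' uni ee; ring.
have hD : discD.[t] = e by move: De'; rewrite hA; lra.
have hC : discC.[t] = 0.
  move: D0; rewrite dE hA hD S0 subrr !mul0r add0r subr0 => /eqP.
  by rewrite mulf_eq0 (gt_eqF (gram_psi_gt0 t)) orbF => /eqP.
move: hA hD S0 hC; rewrite /discA /discD /discS /discC !hornerE.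
move: ((phi N).[t]) ((psi N).[t]) ((phi' N).[t]) ((psi' N).[t]) => a b c d hA hD hS hC.
(* Multiplying [adj M * Phi_N = e I] by [M] recovers [Phi_N = e M]. *)
split.
- by rewrite -[a]mul1r -dM -hA -[RHS]addr0 -(mulr0 (M 0 1)) -hC; ring.
- by rewrite -[b]mul1r -dM -hD -[RHS]addr0 -(mulr0 (M 0 0)) -hS; ring.
- by rewrite -[c]mul1r -dM -hA -[RHS]addr0 -(mulr0 (M 1 1)) -hC; ring.
- by rewrite -[d]mul1r -dM -hD -[RHS]addr0 -(mulr0 (M 1 0)) -hS; ring.
Qed.

Lemma conjC_real (x : R) : (x%:C)^* = x%:C.
Proof. exact: conjc_real. Qed.

(** In one step the terms with the real [1 / f] and [q] cancel; only the difference between [z] and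
    its conjugate survives. *)
Lemma lagrange_identity (z : C) n :
  ((ceval z (psi n))^* * ceval z (psi' n) - ceval z (psi n) * (ceval z (psi' n))^*) =
  ((z^* - z) * \sum_(k < n) (w k.+1)%:C * (ceval z (psi k.+1) * (ceval z (psi k.+1))^*)).
Proof.
elim: n => [|n IHn].
  by rewrite big_ord0 mulr0 /solU /solV /= !cevalC !rmorph0 !mul0r subrr.
rewrite big_ord_recr /= mulrDr -IHn (ceval_solVS f q w z 0 1) (ceval_solUS f q w z 0 1).
rewrite !(rmorphD, rmorphN, rmorphM) /= !conjC_real; ring.
Qed.

(** At a root [M_11 psi = M_01 psi'], so both [M_11] and [M_01] annihilate the boundary bracket.
    Since [det M = 1] they are not both zero and the bracket vanishes, while the sum in the Lagrange
    identity is positive. *)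
Lemma discS_root_real (z : C) : ceval z discS = 0 -> (z^*) = z.
Proof.
rewrite /discS cevalB !cevalZ => /eqP; rewrite subr_eq0 => /eqP h.
have h' := congr1 Num.conj h; rewrite !rmorphM /= !conjC_real in h'.
have := lagrange_identity z N.
set W := (X in X = _); set Q := \sum_(_ < _) _ => L.
have W1 : (M 1 1)%:C * W = 0.
  rewrite /W; move: (ceval z (psi N)) (ceval z (psi' N)) h h' => u v h h'.
  have -> : (M 1 1)%:C * ((u^*) * v - u * (v^*)) =
    (M 1 1)%:C * (u^*) * v - (M 1 1)%:C * u * (v^*) by ring.
  by rewrite h h'; ring.
have W2 : (M 0 1)%:C * W = 0.
  rewrite /W; move: (ceval z (psi N)) (ceval z (psi' N)) h h' => u v h h'.
  have -> : (M 0 1)%:C * ((u^*) * v - u * (v^*)) =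
    (M 0 1)%:C * v * (u^*) - (M 0 1)%:C * (v^*) * u by ring.
  by rewrite -h -h'; ring.
have W0 : W = 0.
  rewrite -[W]mul1r -(rmorph1 (real_complex R)) -detM_entries rmorphB !rmorphM.
  have -> : ((M 0 0)%:C * (M 1 1)%:C - (M 0 1)%:C * (M 1 0)%:C) * W =
    (M 0 0)%:C * ((M 1 1)%:C * W) - (M 1 0)%:C * ((M 0 1)%:C * W) by ring.
  by rewrite W1 W2; ring.
have Q0 : 0 < Q.
  have hN : (0 < N)%N by exact: ltnW.
  rewrite /Q (bigD1 (Ordinal hN)) //=; apply: ltr_pwDl.
    rewrite mulr_gt0 //; first by rewrite ltcR w_gt0 ?hN.
    rewrite solUS /solU /solV /= cevalD cevalZ !cevalC rmorph0 rmorph1 add0r mulr1 conjC_real.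
    by rewrite -rmorphM ltcR -expr2 exprn_even_gt0 //= invr_eq0 f_neq0.
  by apply: sumr_ge0 => k _; rewrite mulr_ge0 ?mul_conjC_ge0 // lecR ltW // weight_gt0.
move: L; rewrite W0 => /esym/eqP; rewrite mulf_eq0 (gt_eqF Q0) orbF subr_eq0.
by move/eqP.
Qed.

Lemma ceval_split_eq0 z (L : R) (s : seq R) : L != 0 ->
  (ceval z (L *: \prod_(x <- s) ('X - x%:P)) == 0) = (z \in map (real_complex R) s).
Proof.
move=> L0; rewrite cevalZ mulf_eq0 fmorph_eq0 (negPf L0) /= /ceval rmorph_prod.
rewrite -root_prod_XsubC big_map /root; congr (_.[_] == 0).
by apply: eq_bigr => x _; rewrite /= map_polyXsubC.
Qed.

(** The complex roots are real, so their real parts already factor [p]; a nonzero derivative at each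
    makes them distinct. *)
Lemma split_real_simple (p : {poly R}) : p != 0 ->
  (forall z, ceval z p = 0 -> z^* = z) -> (forall x, p.[x] = 0 -> p^`().[x] != 0) ->
  exists s : seq R, sorted <%R s /\ p = lead_coef p *: \prod_(x <- s) ('X - x%:P).
Proof.
move=> p0 hreal hsimp.
have [r Dr] := closed_field_poly_normal (map_poly (real_complex R) p).
pose s := sort <=%R (map (@complex.Re R) r).
have ps : p = lead_coef p *: \prod_(x <- s) ('X - x%:P).
  apply: (map_inj_poly (@complexI R) (rmorph0 _)).
  rewrite [LHS]Dr map_polyZ lead_coef_map; congr (_ *: _).
  rewrite rmorph_prod (perm_big (map (@complex.Re R) r)) /=; last by rewrite perm_sort.
  rewrite big_map; apply: eq_big_seq => z zr; rewrite map_polyXsubC /=.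
  congr (_ - _%:P); have : ceval z p = 0.
    apply/eqP; rewrite /ceval Dr hornerZ mulf_eq0 -/(root _ _) root_prod_XsubC zr orbT.
    by [].
  by move/hreal; case: z {zr} => a b [] /eqP; rewrite eqNr => /eqP ->.
exists s; split => //; rewrite lt_sorted_uniq_le sort_le_sorted andbT.
have L0 : lead_coef p != 0 by rewrite lead_coef_eq0.
apply: count_mem_uniq => x.
have [xs|xs] := boolP (x \in s); last by apply/eqP; rewrite -leqn0 leqNgt -has_count has_pred1.
have : p.[x] = 0.
  by apply/eqP; rewrite ps hornerZ mulf_eq0 -/(root _ _) root_prod_XsubC xs orbT.
move/hsimp; rewrite ps deriv_prod_XsubC_eq0 // -leqNgt.
by move=> c1; apply/eqP; rewrite eqn_leq c1 -has_count has_pred1 xs.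
Qed.

End Discriminant.

(** * Lists of eigenvalues *)

Section EigenLists.
Variables (R : realType) (N : nat) (f q w : nat -> R).
Hypothesis N_ge2 : (2 <= N)%N.
Hypothesis f_neq0 : forall n, (n <= N)%N -> f n != 0.
Local Notation C := R[i].
Local Notation "x %:C" := (real_complex R x).
Local Notation phi := (solU f q w 1 0).
Local Notation phi' := (solV f q w 1 0).
Local Notation psi := (solU f q w 0 1).
Local Notation psi' := (solV f q w 0 1).

(** The condition [y_0 = 0] makes the boundary matrix triangular with diagonal [1, - discS]; its
    kernel has dimension at most 1, matching a list without repetitions. *)
Lemma SK_eigen_list (K : 'M[R]_2) (L : R) (s : seq R) : L != 0 -> sorted <%R s ->
  discS N f q w K = L *: \prod_(x <- s) ('X - x%:P) ->
  sl_eigen_list R N f q w (SK_bc K).1 (SK_bc K).2 s.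
Proof.
move=> L0; rewrite lt_sorted_uniq_le => /andP[us ss] Ss; split=> // z.
rewrite sl_multE // mxrank_ker22; set B := bc_matrix _ _ _ _ _ _ _.
have B00 : B 0 0 = 1 by rewrite !mxE /= !mul0r !addr0.
have B10 : B 1 0 = 0 by rewrite !mxE /= !mul0r !addr0.
have B11 : B 1 1 = - ceval z (discS N f q w K).
  by rewrite !mxE /= /discS cevalB !cevalZ add0r; ring.
have B0 : (B == 0) = false.
  by apply/eqP => e; move: B00; rewrite e mxE => /esym/eqP; rewrite oner_eq0.
rewrite det_mx22 B00 B10 B11 mul1r mulr0 subr0 oppr_eq0 Ss ceval_split_eq0 // B0.
rewrite -[count _ s]/(count (preim (real_complex R) (pred1 z)) s) -count_map.
rewrite count_uniq_mem ?map_inj_uniq //; last exact: complexI.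
Qed.

Variable M : 'M[R]_2.
Hypothesis detM : \det M = 1.

Section Coupled.
Variables om z : C.
Let B := bc_matrix N f q w (om *: map_mx (real_complex R) M) (-1) z.

Lemma coupled_bc_entries :
  [/\ B 0 0 = om * (M 0 0)%:C - ceval z (phi N), B 0 1 = om * (M 1 0)%:C - ceval z (phi' N),
      B 1 0 = om * (M 0 1)%:C - ceval z (psi N) & B 1 1 = om * (M 1 1)%:C - ceval z (psi' N)].
Proof. by rewrite !mxE /=; split; ring. Qed.

(** This is [det (om M - Phi) = om ^ 2 det M - om tr (adj M * Phi) + det Phi], with both
    determinants 1. *)
Lemma det_coupled_bc : \det B = om ^+ 2 + 1 - om * ceval z (disc N f q w M).
Proof.
have [B00 B01 B10 B11] := coupled_bc_entries.
rewrite det_mx22 B00 B01 B10 B11 /disc /discA /discD cevalD !cevalB !cevalZ.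
have W : ceval z (phi N) * ceval z (psi' N) - ceval z (psi N) * ceval z (phi' N) = 1.
  by rewrite -!cevalM -cevalB wronskian -polyC1 cevalC rmorph1.
have D : (M 0 0)%:C * (M 1 1)%:C - (M 0 1)%:C * (M 1 0)%:C = 1.
  by rewrite -!rmorphM -rmorphB detM_entries // rmorph1.
rewrite -[om ^+ 2]mulr1 -[in om ^+ 2 * _]D -W; ring.
Qed.

End Coupled.

(** For [om = e^{i gamma}] the determinant is [- om (disc - 2 cos gamma)]. At real [z] the matrix
    [Phi] is real and [om M] is not, so the boundary matrix is nonzero and every eigenvalue is
    simple. *)
Lemma phase_eigen_list (gamma L : R) (s : seq R) : L != 0 -> sin gamma != 0 -> sorted <%R s ->
  disc N f q w M - (2 * cos gamma)%:P = L *: \prod_(x <- s) ('X - x%:P) ->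
  sl_eigen_list R N f q w (phase_bc gamma M).1 (phase_bc gamma M).2 s.
Proof.
move=> L0 sg0; rewrite lt_sorted_uniq_le => /andP[us ss] Ds; split=> // z.
rewrite sl_multE // mxrank_ker22 det_coupled_bc.
set om := Complex _ _; set B := bc_matrix _ _ _ _ _ _ _.
have om2 : om ^+ 2 + 1 = om * (2 * cos gamma)%:C.
  have s2 : sin gamma * sin gamma = 1 - cos gamma * cos gamma.
    by rewrite -(cos2Dsin2 gamma); ring.
  rewrite expr2 /om; simpc; apply/eqP; rewrite eq_complex /=; apply/andP; split; apply/eqP.
    by rewrite ?s2; ring.
  by ring.
have om0 : om != 0 by rewrite eq_complex /= (negPf sg0) andbF.
have -> : om ^+ 2 + 1 - om * ceval z (disc N f q w M) =
    - om * ceval z (disc N f q w M - (2 * cos gamma)%:P).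
  by rewrite om2 cevalB cevalC; ring.
rewrite mulf_eq0 oppr_eq0 (negPf om0) /= Ds ceval_split_eq0 //.
rewrite -[count _ s]/(count (preim (real_complex R) (pred1 z)) s) -count_map.
rewrite count_uniq_mem ?map_inj_uniq //; last exact: complexI.
case: (boolP (_ \in _)) => // /mapP[x _ zx].
case: eqP => // B0; exfalso.
have entry (m p : R) : om * m%:C - p%:C = 0 -> m = 0.
  rewrite /om; simpc => /eqP; rewrite eq_complex /= => /andP[_].
  by rewrite mulf_eq0 (negPf sg0) => /eqP.
have [] := coupled_bc_entries om z; rewrite -/B B0 zx !ceval_real !mxE.
move=> /esym/entry m00 /esym/entry m10 /esym/entry m01 /esym/entry m11.
have := detM_entries detM; rewrite m00 m01 !mul0r subrr => /esym/eqP.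
by rewrite oner_eq0.
Qed.

Hypothesis w_gt0 : forall n, (1 <= n <= N)%N -> 0 < w n.

(** Taking [e] = ±1 covers both [M] and [- M]. A root is repeated exactly when [disc' = 0], that is
    [Phi = e M]; then the boundary matrix is zero and its kernel has dimension 2, which the bound on
    the counts matches. *)
Lemma real_eigen_list (e L : R) (s : seq R) : L != 0 -> e * e = 1 -> sorted <=%R s ->
  (forall x, count_mem x s <= 2)%N ->
  disc N f q w M - (2 * e)%:P = L *: \prod_(x <- s) ('X - x%:P) ->
  sl_eigen_list R N f q w (real_bc (e *: M)).1 (real_bc (e *: M)).2 s.
Proof.
move=> L0 ee ss c2 Ds; split=> // z.
rewrite sl_multE // mxrank_ker22 /real_bc /= map_mxZ det_coupled_bc.
set B := bc_matrix _ _ _ _ _ _ _.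
have eC : e%:C ^+ 2 = 1 by rewrite expr2 -rmorphM ee rmorph1.
have e0 : e%:C != 0.
  by apply/eqP => e0; move: eC; rewrite e0 expr0n => /esym/eqP; rewrite oner_eq0.
have -> : e%:C ^+ 2 + 1 - e%:C * ceval z (disc N f q w M) =
    - e%:C * ceval z (disc N f q w M - (2 * e)%:P).
  rewrite cevalB cevalC mulrBr rmorphM rmorphMn rmorph1.
  have -> : - e%:C * (2 * e%:C) = - (2 * e%:C ^+ 2) by ring.
  by rewrite eC; ring.
rewrite mulf_eq0 oppr_eq0 (negPf e0) /= Ds ceval_split_eq0 //.
rewrite -[count _ s]/(count (preim (real_complex R) (pred1 z)) s) -count_map.
case: (boolP (_ \in _)) => [/mapP[x xs zx]|zs]; last first.
  by apply/esym/eqP; rewrite -leqn0 leqNgt -has_count has_pred1.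
have -> : count_mem z (map (real_complex R) s) = count_mem x s.
  by rewrite count_map; apply: eq_count => y /=; rewrite zx (inj_eq (@complexI R)).
have De : (disc N f q w M).[x] = 2 * e.
  apply/eqP; rewrite -subr_eq0; have := congr1 (horner^~ x) Ds.
  rewrite hornerD hornerN hornerC => ->.
  by rewrite hornerZ mulf_eq0 -/(root _ _) root_prod_XsubC xs orbT.
have c1 : (0 < count_mem x s)%N by rewrite -has_count has_pred1.
have dE := deriv_disc_eq0 N_ge2 f_neq0 w_gt0 detM ee De.
have d0 : ((disc N f q w M)^`().[x] == 0) = (1 < count_mem x s)%N.
  by rewrite -(deriv_prod_XsubC_eq0 L0 xs) -Ds derivB derivC subr0.
have [B00 B01 B10 B11] := coupled_bc_entries e%:C z; rewrite -/B zx !ceval_real -!rmorphM -!rmorphB in B00 B01 B10 B11.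
have B0 : (B == 0) = (1 < count_mem x s)%N.
  rewrite -d0; apply/eqP/eqP.
    move=> B0; apply/dE; rewrite B0 !mxE in B00 B01 B10 B11.
    have r0 (u v : R) : 0 = (u - v)%:C -> v = u.
      by move=> /esym/eqP; rewrite fmorph_eq0 subr_eq0 => /eqP.
    by split; exact: r0.
  move/dE => [h1 h2 h3 h4]; apply/matrixP.
  rewrite h1 h2 h3 h4 !subrr !rmorph0 in B00 B01 B10 B11.
  move=> i j; rewrite [RHS]mxE.
  have two (k : 'I_2) : k = 0 \/ k = 1.
    by case: k => [[|[|k]] hk] //; [left|right]; exact: val_inj.
  by case: (two i) => ->; case: (two j) => ->.
rewrite B0; have := c2 x.
by case: (count_mem x s) c1 => [|[|[|k]]].
Qed.

(** * Leading coefficients of [disc] and [discS] *)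

Hypothesis prodf_gt0 : 0 < \prod_(i < N) (f i)^-1.

Definition psi_lead : R := (psi N)`_N.-1.

(** The coefficient is [1 / f_0] times the product of the [- w_k / f_k] over [1 <= k < N];
    positivity of the weights and of the product of the [1 / f_i] leaves the sign [(-1) ^ N.-1]. *)
Lemma psi_lead_sign : 0 < (-1) ^+ N.-1 * psi_lead.
Proof.
rewrite /psi_lead; case: N N_ge2 w_gt0 prodf_gt0 => // n _ hw hf /=.
have [_ _ -> _] := sol_coef f q w 0 1 n; rewrite add0r div1r.
move: hf; rewrite big_ord_recl /= => hf.
have -> : (-1) ^+ n * ((f 0%N)^-1 * \prod_(k < n) (- w k.+1 / f k.+1)) =
  \prod_(k < n) w k.+1 * ((f 0%N)^-1 * \prod_(i < n) (f (bump 0 i))^-1).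
  have -> : \prod_(k < n) (- w k.+1 / f k.+1) =
     (-1) ^+ n * \prod_(k < n) w k.+1 * \prod_(i < n) (f (bump 0 i))^-1.
    rewrite -[n in (-1) ^+ n]card_ord -prodr_const -!big_split /=.
    by apply: eq_bigr => k _; rewrite mulN1r.
  have : (-1) ^+ n * (-1) ^+ n = 1 :> R by rewrite -exprMn mulrNN mulr1 expr1n.
  move: ((-1) ^+ n) => e ee; rewrite -[RHS]mul1r -ee; ring.
rewrite mulr_gt0 // prodr_gt0 // => k _; apply: hw.
by rewrite /= ltnS ltnW.
Qed.

(** Degree [N] comes only from [phi'] and [psi'], whose top coefficients are in the ratio [f_0]. *)
Lemma disc_lead : (size (disc N f q w M) <= N.+1)%N /\
  (disc N f q w M)`_N = - (w N * psi_lead * (M 0 0 - f 0%N * M 0 1)).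
Proof.
have f0 : f 0%N != 0 by exact: f_neq0.
rewrite /psi_lead /disc /discA /discD; case: N N_ge2 => // n _ /=.
have [s1 s2 c1 c2] := sol_coef f q w 1 0 n; have [s3 s4 c3 c4] := sol_coef f q w 0 1 n.
split; last first.
  rewrite !coefE (nth_default _ s1) (nth_default _ s3) c2 c4 c1 c3; field.
  by rewrite f0.
have sz (m p : R) (u v : {poly R}) : (size u <= n.+1)%N -> (size v <= n.+2)%N ->
    (size (m *: u - p *: v)%R <= n.+2)%N.
  move=> hu hv; apply: leq_trans (size_polyD _ _) _; rewrite geq_max size_polyN.
  by rewrite !(leq_trans (size_scale_leq _ _)) // leqW.
apply: leq_trans (size_polyD _ _) _; rewrite geq_max sz //.
by rewrite -size_polyN opprB sz.
Qed.

(** The degree is [N] or, for [M 0 1 = 0], one less, and then [M 1 1] is nonzero as [det M = 1].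
    This counts the zeros of [discS] available as nodes. *)
Lemma discS_lead :
  (M 0 1 != 0 -> size (discS N f q w M) = N.+1 /\
     lead_coef (discS N f q w M) = w N * psi_lead * M 0 1) /\
  (M 0 1 = 0 -> size (discS N f q w M) = N /\
     lead_coef (discS N f q w M) = psi_lead * M 1 1).
Proof.
have p0 : psi_lead != 0.
  by apply/eqP => p0; have := psi_lead_sign; rewrite p0 mulr0 ltxx.
have w0 : w N != 0 by rewrite gt_eqF // w_gt0 // leqnn ltnW.
have := detM_entries detM; move: p0 w0.
rewrite /psi_lead /discS; case: N N_ge2 => // n _ /= p0 w0 dM.
have [s3 s4 c3 c4] := sol_coef f q w 0 1 n.
have leadE (p : {poly R}) k : (size p <= k.+1)%N -> p`_k != 0 ->
    size p = k.+1 /\ lead_coef p = p`_k.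
  move=> h1 h2; have e : size p = k.+1.
    apply/eqP; rewrite eqn_leq h1 ltnNge; apply/negP => h3.
    by move: h2; rewrite nth_default ?eqxx.
  by rewrite lead_coefE e.
split=> [m0|m0].
  have cE : (M 1 1 *: psi n.+1 - M 0 1 *: psi' n.+1)`_n.+1 = w n.+1 * (psi n.+1)`_n * M 0 1.
    by rewrite !coefE (nth_default _ s3) c4; ring.
  rewrite -cE; apply: leadE.
    apply: leq_trans (size_polyD _ _) _; rewrite geq_max size_polyN.
    by rewrite !(leq_trans (size_scale_leq _ _)) // leqW.
  by rewrite cE !mulf_neq0.
have cE : (M 1 1 *: psi n.+1 - M 0 1 *: psi' n.+1)`_n = (psi n.+1)`_n * M 1 1.
  by rewrite m0 !coefE; ring.
rewrite -cE; apply: leadE.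
  by rewrite m0 scale0r subr0 (leq_trans (size_scale_leq _ _)).
rewrite cE mulf_neq0 //; apply/eqP => m1.
by move: dM; rewrite m0 m1 mulr0 mul0r subr0 => /esym/eqP; rewrite oner_eq0.
Qed.

End EigenLists.

(** * Interlacing *)

Lemma sign_sqr (R : pzRingType) n : (-1) ^+ n * (-1) ^+ n = 1 :> R.
Proof. by rewrite -expr2 sqrr_sign. Qed.

(** * Roots of [D = d] for [|d| <= 2] between alternating nodes *)

Section Levels.
Variables (R : rcfType) (N : nat) (D : {poly R}) (x : nat -> R).
Hypothesis N_gt0 : (0 < N)%N.
Hypothesis sizeD : size D = N.+1.
Hypothesis x_lt : forall j, (j < N)%N -> x j < x j.+1.
Hypothesis D_alt : forall j, (j <= N)%N -> 2 <= (-1) ^+ j * D.[x j].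

Lemma nodes_le i j : (i <= j)%N -> (j <= N)%N -> x i <= x j.
Proof.
elim: j => [|j IHj]; first by rewrite leqn0 => /eqP ->.
rewrite leq_eqVlt => /orP[/eqP -> //|hij hj].
by apply: le_trans (IHj hij (ltnW hj)) (ltW (x_lt hj)).
Qed.

Lemma size_level d : size (D - d%:P) = N.+1.
Proof.
rewrite size_polyDl // sizeD size_polyN.
exact: leq_ltn_trans (size_polyC_leq1 _) _.
Qed.

Lemma level_sign (d : R) j : -2 <= d <= 2 -> -2 <= (-1) ^+ j * d <= 2.
Proof.
by case/andP=> h1 h2; rewrite -signr_odd; case: (odd j); rewrite ?expr0 ?expr1; apply/andP; split; lra.
Qed.

Lemma level_sign_lt (d : R) j : -2 < d < 2 -> -2 < (-1) ^+ j * d < 2.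
Proof.
by case/andP=> h1 h2; rewrite -signr_odd; case: (odd j); rewrite ?expr0 ?expr1; apply/andP; split; lra.
Qed.

(** [D - d] weakly alternates on the nodes, and the [N] roots this gives exhaust its degree. *)
Lemma level_roots (d : R) : -2 <= d <= 2 -> exists r : nat -> R,
  (forall j, (j < N)%N -> x j <= r j <= x j.+1) /\
  D - d%:P = lead_coef (D - d%:P) *: \prod_(z <- mkseq r N) ('X - z%:P).
Proof.
move=> hd; have [|j hj|r [h1 h2]] := @weakly_alternating_roots R N (D - d%:P) x.
- exact: x_lt.
- rewrite hornerD hornerN hornerC mulrBr subr_ge0.
  by have := D_alt hj; case/andP: (level_sign j hd); lra.
by exists r; split=> //; apply: dvdp_prod_XsubC_eq => //; exact: size_level.
Qed.

Lemma level_root_mem d r j : D - d%:P = lead_coef (D - d%:P) *: \prod_(z <- mkseq r N) ('X - z%:P) ->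
  (j < N)%N -> D.[r j] = d.
Proof.
move=> e hj; apply/eqP; rewrite -subr_eq0; have := congr1 (horner^~ (r j)) e.
rewrite hornerD hornerN hornerC => ->.
rewrite hornerZ mulf_eq0 -/(root _ _) root_prod_XsubC; apply/orP; right.
by apply/mapP; exists j => //; rewrite mem_iota.
Qed.

Section Interior.
Variables (d : R) (c : nat -> R).
Hypothesis d_lt : -2 < d < 2.
Hypothesis c_in : forall j, (j < N)%N -> x j <= c j <= x j.+1.
Hypothesis Dc : D - d%:P = lead_coef (D - d%:P) *: \prod_(z <- mkseq c N) ('X - z%:P).

Lemma interior_strict j : (j < N)%N -> x j < c j < x j.+1.
Proof.
move=> hj; case/andP: (c_in hj) => h1 h2; have Dj := level_root_mem Dc hj.
apply/andP; split; rewrite lt_neqAle ?h1 ?h2 andbT; apply/eqP => e.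
  have := D_alt (ltnW hj); rewrite e Dj.
  by case/andP: (level_sign_lt j d_lt); lra.
have := D_alt hj; rewrite -e Dj.
by case/andP: (level_sign_lt j.+1 d_lt); lra.
Qed.

Lemma interior_sorted : sorted <%R (mkseq c N).
Proof.
apply: lt_image_sorted => j hj.
case/andP: (interior_strict (ltnW hj)) => _ h1; case/andP: (interior_strict hj) => h2 _.
exact: lt_trans h1 h2.
Qed.

(** All roots are among the [c i], and those with [i] different from [j] lie in the interiors of
    other intervals. *)
Lemma interior_unique j y : (j < N)%N -> x j <= y <= x j.+1 -> root (D - d%:P) y -> y = c j.
Proof.
move=> hj /andP[h1 h2].
have L0 : lead_coef (D - d%:P) != 0 by rewrite lead_coef_eq0 -size_poly_gt0 size_level.
rewrite Dc rootZ // root_prod_XsubC => yc; case: (elimT (nthP 0) yc) => i; rewrite size_mkseq => hi.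
rewrite nth_mkseq // => /esym yi.
rewrite yi; case: (ltngtP i j) => [hij|hij|-> //]; exfalso.
  case/andP: (interior_strict hi) => _ h3; have := nodes_le hij (ltnW hj).
  by move: h1 h2; rewrite yi; lra.
case/andP: (interior_strict hi) => h3 _; have := nodes_le hij (ltnW hi).
by move: h1 h2; rewrite yi; lra.
Qed.

(** Up to the sign [(-1) ^ j], [D - d] is positive at [g] and negative at [x j.+1], so there is a
    root to the right of [g]; by uniqueness it is [c j]. *)
Lemma below_interior j g : (j < N)%N -> x j <= g <= x j.+1 ->
  (-1) ^+ j * D.[g] = 2 -> g < c j.
Proof.
move=> hj /andP[h1 h2] hg; rewrite ltNge; apply/negP => cg.
have [|y] := @poly_ivtoo _ (D - d%:P) g (x j.+1) h2.
  rewrite !hornerD !hornerN !hornerC.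
  have -> : (D.[g] - d) * (D.[x j.+1] - d) =
    ((-1) ^+ j * D.[g] - (-1) ^+ j * d) * ((-1) ^+ j * D.[x j.+1] - (-1) ^+ j * d).
    rewrite -!mulrBr mulrACA sign_sqr mul1r; ring.
  have := D_alt hj; rewrite exprS mulN1r mulNr hg.
  case/andP: (level_sign_lt j d_lt) => e1 e2 e3.
  by rewrite pmulr_rlt0; lra.
rewrite in_itv /= => /andP[y1 y2] ry.
have := interior_unique hj _ ry; rewrite (ltW y2) (le_trans h1 (ltW y1)) => /(_ isT) e.
by move: y1; rewrite e ltNge cg.
Qed.

Lemma above_interior j g : (j < N)%N -> x j <= g <= x j.+1 ->
  (-1) ^+ j * D.[g] = -2 -> c j < g.
Proof.
move=> hj /andP[h1 h2] hg; rewrite ltNge; apply/negP => cg.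
have [|y] := @poly_ivtoo _ (D - d%:P) (x j) g h1.
  rewrite !hornerD !hornerN !hornerC.
  have -> : (D.[x j] - d) * (D.[g] - d) =
    ((-1) ^+ j * D.[x j] - (-1) ^+ j * d) * ((-1) ^+ j * D.[g] - (-1) ^+ j * d).
    rewrite -!mulrBr mulrACA sign_sqr mul1r; ring.
  have := D_alt (ltnW hj); rewrite hg.
  case/andP: (level_sign_lt j d_lt) => e1 e2 e3.
  by rewrite pmulr_rlt0; lra.
rewrite in_itv /= => /andP[y1 y2] ry.
have := interior_unique hj _ ry; rewrite (ltW y1) (le_trans (ltW y2) h2) => /(_ isT) e.
by move: y2; rewrite e ltNge cg.
Qed.

End Interior.

Lemma level_sorted r : (forall j, (j < N)%N -> x j <= r j <= x j.+1) -> sorted <=%R (mkseq r N).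
Proof.
move=> h; apply: le_image_sorted => j hj.
case/andP: (h _ (ltnW hj)) => _ h1; case/andP: (h _ hj) => h2 _.
exact: le_trans h1 h2.
Qed.

(** Roots two places apart are separated by a whole interval between nodes. *)
Lemma level_count r : (forall j, (j < N)%N -> x j <= r j <= x j.+1) ->
  forall z, (count_mem z (mkseq r N) <= 2)%N.
Proof.
move=> h z; apply: count_mem_le2; first exact: level_sorted.
move=> j; rewrite size_mkseq => hj; rewrite !nth_mkseq //; last by rewrite ltnW // ltnW.
case/andP: (h j (ltnW (ltnW hj))) => _ h1; case/andP: (h _ hj) => h2 _.
by apply: le_lt_trans h1 _; apply: lt_le_trans h2; exact: x_lt (ltnW hj).
Qed.

End Levels.

(** * Eigenvalues between nodes, and the discriminant at the zeros of [discS] *)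

Section Interlacing.
Variables (R : realType) (N : nat) (f q w : nat -> R) (gamma : R) (M : 'M[R]_2).
Hypothesis N_ge2 : (2 <= N)%N.
Hypothesis f_neq0 : forall n, (n <= N)%N -> f n != 0.
Hypothesis w_gt0 : forall n, (1 <= n <= N)%N -> 0 < w n.
Hypothesis prodf_gt0 : 0 < \prod_(i < N) (f i)^-1.
Hypothesis gamma_pi : - pi < gamma < pi.
Hypothesis gamma_neq0 : gamma != 0.
Hypothesis detM : \det M = 1.
Hypothesis M_pos : 0 < M 0 0 - f 0%N * M 0 1.

Lemma sin_gamma_neq0 : sin gamma != 0.
Proof.
case/andP: gamma_pi => h1 h2; case: (ltrgtP gamma 0) => h.
- rewrite -oppr_eq0 -sinN gt_eqF // sin_gt0_pi //; apply/andP; split; lra.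
- by rewrite gt_eqF // sin_gt0_pi // h h2.
- by move: gamma_neq0; rewrite h eqxx.
Qed.

Lemma cos_gamma_lt : -2 < 2 * cos gamma < 2.
Proof.
have h := cos2Dsin2 gamma.
have : 0 < sin gamma ^+ 2 by rewrite exprn_even_gt0 //= sin_gamma_neq0.
by move: h; move: (cos gamma) (sin gamma ^+ 2) => c s h1 h2; apply/andP; split; nra.
Qed.

Let D := disc N f q w M.
Let lamM := eig_bc N f q w (real_bc M).
Let lamnM := eig_bc N f q w (real_bc (- M)).
Let lamgM := eig_bc N f q w (phase_bc gamma M).

Lemma disc_lead_sign : 0 < (-1) ^+ N * D`_N.
Proof.
have [_ ->] := disc_lead q w N_ge2 f_neq0 M.
have := psi_lead_sign q N_ge2 w_gt0 prodf_gt0.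
have : 0 < w N by rewrite w_gt0 // leqnn ltnW.
move: (psi_lead _ _ _ _) => l; case: N N_ge2 => // n _ /= hw hp.
rewrite exprS mulN1r mulrNN.
rewrite [X in 0 < X](_ : _ = w n.+1 * ((-1) ^+ n * l) * (M 0 0 - f 0%N * M 0 1)); last by ring.
by rewrite mulr_gt0 // mulr_gt0.
Qed.

Lemma size_disc : size D = N.+1.
Proof.
have [s1 _] := disc_lead q w N_ge2 f_neq0 M.
apply/eqP; rewrite eqn_leq s1 ltnNge; apply/negP => h.
by have := disc_lead_sign; rewrite nth_default // mulr0 ltxx.
Qed.

Lemma lead_coef_disc : lead_coef D = D`_N.
Proof. by rewrite lead_coefE size_disc. Qed.

(** Source of an extra node to the right of the zeros of [discS], with the sign that alternation
    requires of the last node. *)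
Lemma disc_pinfty m : exists T, m < T /\ 2 <= (-1) ^+ N * D.[T].
Proof.
pose p := (-1) ^+ N *: D - 2%:P.
have ltC : (size (- 2%:P : {poly R})%R < size ((-1) ^+ N *: D)%R)%N.
  rewrite size_scale ?signr_eq0 // size_disc size_polyN ltnS.
  by apply: leq_trans (size_polyC_leq1 _) _; rewrite ltnW.
have [|T [h1 h2]] := @poly_pinfty_gt R p m.
  by rewrite /p lead_coefDl // lead_coefZ lead_coef_disc disc_lead_sign.
exists T; split=> //; move: h2.
by rewrite /p hornerD hornerN hornerC hornerZ subr_gt0 => /ltW.
Qed.

Lemma disc_minfty m : exists T, T < m /\ 2 <= D.[T].
Proof.
have ltC : (size (- 2%:P : {poly R})%R < size D)%N.
  rewrite size_disc size_polyN ltnS.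
  by apply: leq_trans (size_polyC_leq1 _) _; rewrite ltnW.
have [|T [h1 h2]] := @poly_minfty_lt R (D - 2%:P) m.
  by rewrite lead_coefDl // size_polyDl // size_disc lead_coef_disc disc_lead_sign.
exists T; split=> //; move: h2.
by rewrite hornerD hornerN hornerC subr_gt0 => /ltW.
Qed.

(** The eigenvalues for [M], [- M] and [e^{i gamma} M] are the roots of [disc] at the levels 2, -2
    and [2 cos gamma], one per interval; the parity of [j] decides whether [disc] passes from above
    2 to below -2 or the other way. *)
Lemma eigenvalues_between_nodes (x : nat -> R) :
  (forall j, (j < N)%N -> x j < x j.+1) ->
  (forall j, (j <= N)%N -> 2 <= (-1) ^+ j * D.[x j]) ->
  [/\ forall j, (j < N)%N -> if odd j then lamnM j < lamgM j < lamM j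
      else lamM j < lamgM j < lamnM j,
      forall j, (j < N)%N -> x j <= lamM j <= x j.+1 &
      forall j, (j < N)%N -> x j <= lamnM j <= x j.+1].
Proof.
move=> x_lt D_alt; have N0 : (0 < N)%N by exact: ltnW.
have sD := size_disc.
have L0 (d : R) : lead_coef (D - d%:P) != 0.
  by rewrite lead_coef_eq0 -size_poly_gt0 (size_level N0 sD).
have [|a [ha Da]] := level_roots N0 sD x_lt D_alt (d := 2 * 1); first by apply/andP; split; lra.
have [|b [hb Db]] := level_roots N0 sD x_lt D_alt (d := 2 * -1); first by apply/andP; split; lra.
have cg := cos_gamma_lt.
have [|c [hc Dc]] := level_roots N0 sD x_lt D_alt (d := 2 * cos gamma).
  by case/andP: cg => c1 c2; rewrite !ltW.
have aE j : (j < N)%N -> lamM j = a j.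
  move=> hj; rewrite /lamM /eig_bc /sl_eig -{1 2}[M]scale1r.
  rewrite (sl_spectrumE (s := mkseq a N)) ?nth_mkseq //.
  apply: (real_eigen_list N_ge2 f_neq0 detM w_gt0 (L0 (2 * 1))) => //.
  - exact: mulr1.
  - exact: level_sorted ha.
  - by move=> z; exact (level_count x_lt ha z).
have bE j : (j < N)%N -> lamnM j = b j.
  move=> hj; rewrite /lamnM /eig_bc /sl_eig -{1 2}scaleN1r.
  rewrite (sl_spectrumE (s := mkseq b N)) ?nth_mkseq //.
  apply: (real_eigen_list N_ge2 f_neq0 detM w_gt0 (L0 (2 * -1))) => //.
  - by rewrite mulrNN mulr1.
  - exact: level_sorted hb.
  - by move=> z; exact (level_count x_lt hb z).
have cE j : (j < N)%N -> lamgM j = c j.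
  move=> hj; rewrite /lamgM /eig_bc /sl_eig.
  rewrite (sl_spectrumE (s := mkseq c N)) ?nth_mkseq //.
  apply: (phase_eigen_list f_neq0 detM (L0 (2 * cos gamma))) => //.
  - exact: sin_gamma_neq0.
  - exact: (interior_sorted D_alt cg hc Dc).
split=> j hj; rewrite ?aE ?bE ?cE //; [|exact: ha|exact: hb].
have Daj := level_root_mem Da hj; have Dbj := level_root_mem Db hj.
case: ifP => oj; apply/andP; split.
- apply: (below_interior N0 sD x_lt D_alt cg hc Dc hj (hb j hj)).
  by rewrite Dbj -signr_odd oj expr1; ring.
- apply: (above_interior N0 sD x_lt D_alt cg hc Dc hj (ha j hj)).
  by rewrite Daj -signr_odd oj expr1; ring.
- apply: (below_interior N0 sD x_lt D_alt cg hc Dc hj (ha j hj)).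
  by rewrite Daj -signr_odd oj expr0; ring.
- apply: (above_interior N0 sD x_lt D_alt cg hc Dc hj (hb j hj)).
  by rewrite Dbj -signr_odd oj expr0; ring.
Qed.

Let S := discS N f q w M.

Lemma discS_split : exists s : seq R,
  [/\ sorted <%R s, (size s).+1 = size S & S = lead_coef S *: \prod_(x <- s) ('X - x%:P)].
Proof.
have S0 : S != 0.
  have [h1 h2] := discS_lead q N_ge2 detM w_gt0 prodf_gt0.
  rewrite -size_poly_gt0 /S; have [m0|m0] := eqVneq (M 0 1) 0.
    by case: (h2 m0) => -> _; exact: ltnW.
  by case: (h1 m0) => -> _.
have [||s [h1 h2]] := split_real_simple S0.
- exact: discS_root_real N_ge2 f_neq0 w_gt0 detM.
- move=> t /(disc_at_root_discS N_ge2 f_neq0 w_gt0 detM) [h _].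
  by apply/eqP => e; move: h; rewrite e mulr0 ltxx.
exists s; split=> //; rewrite h2 size_scale ?lead_coef_eq0 //.
by rewrite size_prod_XsubC.
Qed.

(** At the zeros [disc] has the sign of the derivative of [discS], which alternates, and
    [disc ^ 2 >= 4] turns the sign into a bound by 2. The sign [tau] is 1 when the first zero serves
    as node 0 and -1 when a point to its left does. *)
Lemma disc_at_discS_roots (tau : R) (s : seq R) j : tau * tau = 1 -> sorted <%R s ->
  S = lead_coef S *: \prod_(x <- s) ('X - x%:P) ->
  0 < tau * ((-1) ^+ (size s).-1 * lead_coef S) -> (j < size s)%N ->
  2 <= tau * ((-1) ^+ j * D.[nth 0 s j]).
Proof.
move=> tt ss Ss hL hj; set t := nth 0 s j.
have St : S.[t] = 0.
  apply/eqP; rewrite Ss hornerZ mulf_eq0 -/(root _ _) root_prod_XsubC mem_nth // orbT.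
  by [].
have [h1 h2] := disc_at_root_discS N_ge2 f_neq0 w_gt0 detM St.
have := deriv_prod_XsubC_sign ss hj; rewrite -/t => h3.
have h4 : S^`().[t] = lead_coef S * (\prod_(x <- s) ('X - x%:P))^`().[t].
  by rewrite {1}Ss derivZ hornerZ.
rewrite -/S -/D h4 in h1 h2; move: h1 h2 h3 hL; rewrite -/D.
have := sign_sqr R (size s).-1; have := sign_sqr R j; rewrite -/S.
move: ((-1 : R) ^+ j) ((-1 : R) ^+ (size s).-1) (lead_coef S) (_^`().[t]) D.[t] => e1 e2 L X d e11 e22 h1 h2 h3 hL.
have hh : 0 < tau * (e1 * d).
  have : 0 < (tau * (e2 * L)) * (e2 * (e1 * X)) * (d * (L * X)) by apply: mulr_gt0 => //; apply: mulr_gt0.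
  have -> : (tau * (e2 * L)) * (e2 * (e1 * X)) * (d * (L * X)) =
    (e2 * e2) * (tau * (e1 * d)) * ((L * X) * (L * X)) by ring.
  rewrite e22 mul1r => h; case: (ltrP 0 (tau * (e1 * d))) => // h'.
  have := sqr_ge0 (L * X); rewrite expr2 => h5.
  by move: h; rewrite ltNge mulr_le0_ge0.
have : (tau * (e1 * d)) ^+ 2 = d ^+ 2.
  have -> : (tau * (e1 * d)) ^+ 2 = (tau * tau) * (e1 * e1) * d ^+ 2 by ring.
  by rewrite tt e11 !mul1r.
by move: hh h2; move: (tau * (e1 * d)) => y; nra.
Qed.

End Interlacing.

(** * Choice of nodes in the three cases *)

Theorem theorem3p8 (R : realType) (N : nat) (f q w : nat -> R)
    (gamma : R) (K M : 'M[R]_2) :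
  (2 <= N)%N ->
  (forall n, (n <= N)%N -> f n != 0) ->
  (forall n, (1 <= n <= N)%N -> 0 < w n) ->
  0 < \prod_(i < N) (f i)^-1 ->
  - pi < gamma < pi -> gamma != 0 ->
  \det K = 1 ->
  K 0 0 - f 0%N * K 0 1 != 0 ->
  (M = K \/ M = - K) ->
  let lamM := eig_bc N f q w (real_bc M) in
  let lamnM := eig_bc N f q w (real_bc (- M)) in
  let lamgM := eig_bc N f q w (phase_bc gamma M) in
  let lamS := eig_bc N f q w (SK_bc K) in
  let mn j := Num.min (lamM j) (lamnM j) in
  let mx j := Num.max (lamM j) (lamnM j) in
  let P := forall j, (j < N)%N ->
      if odd j then lamnM j < lamgM j < lamM j
      else lamM j < lamgM j < lamnM j in
  [/\ (0 < M 0 0 - f 0%N * M 0 1 -> 0 < M 0 1 ->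
        [/\ P,
            forall j, (j < N)%N -> lamS j <= mn j &
            forall j, (j.+1 < N)%N -> mx j <= lamS j.+1]),
      (0 < M 0 0 - f 0%N * M 0 1 -> M 0 1 < 0 ->
        [/\ P,
            forall j, (j.+1 < N)%N -> mx j <= lamS j <= mn j.+1 &
            mx N.-1 <= lamS N.-1]) &
      (0 < M 0 0 -> M 0 1 = 0 ->
        P /\ forall j, (j.+1 < N)%N -> mx j <= lamS j <= mn j.+1)].
Proof.
move=> N2.
have last_eq j : (j < N)%N -> (N <= j.+1)%N -> j = N.-1 by lia.
have N_eq2 : N = N.-2.+2 by lia.
have ltN1 : (N.-1 < N)%N by lia.
move=> hf hw hprod hg g0 detK _ MK lamM lamnM lamgM lamS mn mx P.
have detM : \det M = 1.
  by case: MK => -> //; rewrite -detK !det_mx22 !mxE; ring.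
have [s [ss szs Ss]] := discS_split q N2 hf hw hprod detM.
set S := discS N f q w M in szs Ss.
have [hS1 hS2] := discS_lead q N2 detM hw hprod; rewrite -/S in hS1 hS2.
have lS := psi_lead_sign q N2 hw hprod; set l := psi_lead N f q w in lS hS1 hS2.
have hwN : 0 < w N by rewrite hw // leqnn ltnW.
have S0 : lead_coef S != 0.
  by rewrite lead_coef_eq0 -size_poly_gt0 -szs.
have lamSE j : lamS j = nth 0 s j.
  rewrite /lamS /eig_bc /sl_eig (sl_spectrumE (s := s)) //.
  case: MK => MK.
    by apply: (SK_eigen_list hf (L := lead_coef S)) => //; rewrite -MK.
  (* For [K = - M] the polynomial [discS] changes sign, so only the constant factor changes. *)
  apply: (SK_eigen_list hf (L := - lead_coef S)) => //; first by rewrite oppr_eq0.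
  rewrite scaleNr -Ss /S MK /discS !mxE !scaleNr opprB opprK addrC.
  by [].
have s_lt j : (j.+1 < size s)%N -> nth 0 s j < nth 0 s j.+1.
  by move=> hj; rewrite (lt_sorted_ltn_nth 0 ss) // inE ltnW.
have alt (tau : R) j (tt : tau * tau = 1) :=
  @disc_at_discS_roots _ _ _ q _ _ N2 hf hw detM tau s j tt ss Ss.
have between (x : nat -> R) : 0 < M 0 0 - f 0%N * M 0 1 ->
    (forall j, (j < N)%N -> x j < x j.+1) ->
    (forall j, (j <= N)%N -> 2 <= (-1) ^+ j * (disc N f q w M).[x j]) ->
    [/\ P, forall j, (j < N)%N -> x j <= lamM j <= x j.+1 &
        forall j, (j < N)%N -> x j <= lamnM j <= x j.+1].
  by move=> Mp; exact: (eigenvalues_between_nodes N2 hf hw hprod hg g0 detM Mp).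
clearbody lamM lamnM lamgM lamS.
have mnP j a : a <= lamM j -> a <= lamnM j -> a <= mn j by rewrite /mn le_min => -> ->.
have mxP j a : lamM j <= a -> lamnM j <= a -> mx j <= a by rewrite /mx ge_max => -> ->.
split.
(* Case (i): [discS] has [N] zeros, the nodes 0 to [N - 1], and the default [T] of [nth] serves as
   node [N]. Thus [lamS j] is node [j]. *)
- move=> Mp m1; have m0 : M 0 1 != 0 by rewrite gt_eqF.
  have [szS lcS] := hS1 m0; rewrite szS in szs; case: szs => szs.
  have [T [hT DT]] := disc_pinfty q N2 hf hw hprod Mp (nth 0 s N.-1).
  have xE j : (j < N)%N -> nth T s j = nth 0 s j.
    by move=> hj; apply: set_nth_default; rewrite szs.
  have [||hP h1 h2] := between (nth T s) Mp.
  + move=> j hj; rewrite xE //; have [hj1|hj1] := ltnP j.+1 N.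
      by rewrite xE // s_lt // szs.
    have -> : nth T s j.+1 = T by rewrite nth_default // szs.
    by rewrite (last_eq j hj hj1).
  + move=> j; rewrite leq_eqVlt => /orP[/eqP ->|hj].
      by rewrite nth_default // szs.
    rewrite xE // -[_ * _]mul1r; apply: alt; rewrite ?szs ?mulr1 // mul1r lcS.
    rewrite [X in 0 < X](_ : _ = ((-1) ^+ N.-1 * l) * (w N * M 0 1)); last by ring.
    by rewrite (mulr_gt0 lS) // mulr_gt0.
  split=> // j hj.
    have [h3 _] := andP (h1 j hj); have [h4 _] := andP (h2 j hj).
    rewrite lamSE -(xE j hj); exact: (mnP _ _ h3 h4).
  have [_ h3] := andP (h1 j (ltnW hj)); have [_ h4] := andP (h2 j (ltnW hj)).
  rewrite lamSE -(xE _ hj); exact: (mxP _ _ h3 h4).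
(* Case (ii): again [N] zeros, but the sign of [M 0 1] reverses that of [disc] on them, so a point
   [T] to their left is put in front and [lamS j] is node [j + 1]. *)
- move=> Mp m1; have m0 : M 0 1 != 0 by rewrite lt_eqF.
  have [szS lcS] := hS1 m0; rewrite szS in szs; case: szs => szs.
  have [T [hT DT]] := disc_minfty q N2 hf hw hprod Mp (nth 0 s 0).
  have [||hP h1 h2] := between (nth 0 (T :: s)) Mp.
  + by case=> [|j] hj //=; rewrite s_lt // szs.
  + case=> [|j] hj; first by rewrite expr0 mul1r.
    rewrite exprS -mulrA; apply: alt; rewrite ?szs ?mulrNN ?mulr1 // mulN1r lcS.
    rewrite [X in 0 < X](_ : _ = ((-1) ^+ N.-1 * l) * (w N * - M 0 1)); last by ring.
    by rewrite (mulr_gt0 lS) // mulr_gt0 // oppr_gt0.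
  split=> // [j hj|].
    have [_ h3] := andP (h1 j (ltnW hj)); have [_ h4] := andP (h2 j (ltnW hj)).
    have [h5 _] := andP (h1 j.+1 hj); have [h6 _] := andP (h2 j.+1 hj).
    rewrite lamSE; apply/andP; split; [exact: (mxP _ _ h3 h4)|exact: (mnP _ _ h5 h6)].
  have [_ h3] := andP (h1 _ ltN1); have [_ h4] := andP (h2 _ ltN1).
  rewrite lamSE; exact: (mxP _ _ h3 h4).
(* Case (iii): [discS] has only [N - 1] zeros, so a point is added at each end, [T'] as node 0 and
   the default [T] as node [N]. *)
- move=> m0 m1; have Mp : 0 < M 0 0 - f 0%N * M 0 1 by rewrite m1 mulr0 subr0.
  have [szS lcS] := hS2 m1; rewrite szS in szs.
  (* This fixes the sign of the leading coefficient of [discS]. *)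
  have M11 : 0 < M 1 1.
    by have := detM_entries detM; rewrite m1 mul0r subr0 => e; rewrite -(pmulr_rgt0 _ m0) e.
  have [T' [hT' DT']] := disc_minfty q N2 hf hw hprod Mp (nth 0 s 0).
  have [T [hT DT]] := disc_pinfty q N2 hf hw hprod Mp (nth 0 s N.-2).
  have xE j : (j.+1 < N)%N -> nth T (T' :: s) j.+1 = nth 0 s j.
    by move=> hj; rewrite /= (set_nth_default 0) // -ltnS szs.
  have xN : nth T (T' :: s) N = T by rewrite nth_default // -szs.
  have [||hP h1 h2] := between (nth T (T' :: s)) Mp.
  + case=> [|j] hj; first by rewrite xE.
    rewrite xE //; have [hj2|hj2] := ltnP j.+2 N.
      by rewrite xE // s_lt // -ltnS szs.
    have jN : j = N.-2 by rewrite -[j]/(j.+1.-1) (last_eq _ hj hj2).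
    by rewrite [in j.+2]jN -N_eq2 xN jN.
  + case=> [|j]; first by rewrite expr0 mul1r.
    rewrite leq_eqVlt => /orP[/eqP ->|hj]; first by rewrite xN.
    rewrite xE // exprS -mulrA; apply: alt; rewrite ?mulrNN ?mulr1 //; last by rewrite -ltnS szs.
    rewrite lcS; have -> : (size s).-1 = N.-2 by rewrite -szs.
    move: lS; have -> : N.-1 = N.-2.+1 by rewrite {1}N_eq2.
    rewrite exprS => lS'.
    rewrite [X in 0 < X](_ : _ = (-1 * (-1) ^+ N.-2 * l) * M 1 1); last by ring.
    exact: (mulr_gt0 lS').
  split=> // j hj.
  have [_ h3] := andP (h1 j (ltnW hj)); have [_ h4] := andP (h2 j (ltnW hj)).
  have [h5 _] := andP (h1 j.+1 hj); have [h6 _] := andP (h2 j.+1 hj).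
  rewrite lamSE -(xE _ hj); apply/andP; split; [exact: (mxP _ _ h3 h4)|exact: (mnP _ _ h5 h6)].
Qed.
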